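(* Let $t_0<t_1$, $x_1\in\mathbb{R}^n$, $0<\alpha\le 1$, $\beta>0$, let $L=L(t,x,y)$ be a real-valued function of $(t,x,y)\in[t_0,t_1]\times\mathbb{R}^n\times\mathbb{R}^n$ and $l:\mathbb{R}^n\to\mathbb{R}$. Let $x^0\in PC^{\alpha}([t_0,t_1],\mathbb{R}^n)$ deliver a weak local minimum in the problem $$(P_1)\qquad J(x(\cdot))=\int_{t_0}^{t_1}(t_1-t)^{\beta-1}L\big(t,x(t),({}^{c}D_{t_0+}^{\alpha}x)(t)\big)\,dt+l(x(t_0)),\qquad x(t_1)=x_1,$$ considered in $PC^{\alpha}([t_0,t_1],\mathbb{R}^n)$. Assume that $L,L_x,L_y,L_{xx},L_{xy},L_{yy}$ are continuous in some neighborhood of the graph $\{(t,x^0(t),({}^{c}D_{t_0+}^{\alpha}x^0)(t)) : t\in[t_0,t_1]\}$ and that $l$ is twice continuously differentiable in a neighborhood of the point $x^0(t_0)$. Let $T_1\subset(t_0,t_1)$ be the set of continuity points of ${}^{c}D_{t_0+}^{\alpha}x^0$ and let $P(t)=L_{yy}(t,x^0(t),({}^{c}D_{t_0+}^{\alpha}x^0)(t))$. Then $$\langle P(t)r,r\rangle\ge0\qquad\text{for all } t\in T_1 \text{ and all } r\in\mathbb{R}^n.$$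
   Context: For $\alpha>0$: $(I_{t_0+}^{\alpha}\varphi)(t)=\frac{1}{\Gamma(\alpha)}\int_{t_0}^{t}(t-\tau)^{\alpha-1}\varphi(\tau)\,d\tau$ (left-sided Riemann–Liouville fractional integral), and $I^0_{t_0+}\varphi=\varphi$. For $0<\alpha\le1$ the left-sided Caputo derivative of a continuous $\varphi$ is $({}^{c}D_{t_0+}^{\alpha}\varphi)(t)=\frac{d}{dt}\big(I_{t_0+}^{1-\alpha}(\varphi(\cdot)-\varphi(t_0))\big)(t)$, where $I_{t_0+}^{1-\alpha}(\varphi(\cdot)-\varphi(t_0))$ is required to be absolutely continuous on $[t_0,t_1]$. $PC^{\alpha}([t_0,t_1],\mathbb{R}^n)$ is the set of continuous functions $\varphi:[t_0,t_1]\to\mathbb{R}^n$ whose Caputo derivative ${}^{c}D_{t_0+}^{\alpha}\varphi$ is continuous everywhere on $[t_0,t_1]$ except at finitely many points of $(t_0,t_1)$, where it has discontinuities of the first kind (finite one-sided limits). Functions $x\in PC^{\alpha}([t_0,t_1],\mathbb{R}^n)$ with $x(t_1)=x_1$ are admissible. An admissible $x^0$ delivers a weak local minimum in $(P_1)$ if there is $\delta>0$ such that $J(x(\cdot))\ge J(x^0(\cdot))$ for every admissible $x$ with $\sup_{t}\|x(t)-x^0(t)\|+\sup_{t}\|({}^{c}D_{t_0+}^{\alpha}(x-x^0))(t)\|<\delta$, the second supremum being over the points where the derivative is defined. $L_x,L_y$ are the gradients and $L_{xx},L_{xy},L_{yy}$ the matrices of second partial derivatives of $L$ in the vector variables $x,y$;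 $\langle\cdot,\cdot\rangle$ is the scalar product in $\mathbb{R}^n$. Neighborhoods of the graph are relative to $[t_0,t_1]\times\mathbb{R}^n\times\mathbb{R}^n$. At a discontinuity point of ${}^{c}D_{t_0+}^{\alpha}x^0$ the graph is understood to contain the points corresponding to both one-sided limits. *)

(* Defs.v *)
From HB Require Import structures.
From mathcomp Require Import all_boot all_order all_algebra.
From mathcomp Require Import all_classical all_reals all_analysis.

Set Implicit Arguments.
Unset Strict Implicit.
Unset Printing Implicit Defensive.

Import Order.TTheory GRing.Theory Num.Theory.
Import numFieldNormedType.Exports.

Local Open Scope classical_set_scope.
Local Open Scope ring_scope.

(* R^n is 'cV[R]_n.  A function on [t0, t1] is represented by a total function
   on R; no notion below depends on its values outside [t0, t1]. *)

Section Euclidean.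
Variables (R : realType) (n : nat).

Definition dotp (u v : 'cV[R]_n) : R := \sum_(i < n) u i ord0 * v i ord0.

Definition enorm (u : 'cV[R]_n) : R := Num.sqrt (dotp u u).

End Euclidean.

Section FractionalCalculus.
Variables (R : realType) (n : nat).
Implicit Types (phi : R -> 'cV[R]_n) (a t : R).

Definition Gamma a : R :=
  \int[lebesgue_measure]_(s in `]0, +oo[) (s `^ (a - 1) * expR (- s)).

Definition frac_int t0 a phi t : 'cV[R]_n :=
  if a == 0 then phi t
  else \col_i ((Gamma a)^-1 *
    \int[lebesgue_measure]_(s in `[t0, t]) ((t - s) `^ (a - 1) * phi s i ord0)).

Definition abs_continuous t0 t1 phi : Prop :=
  forall e : R, 0 < e -> exists2 d : R, 0 < d &
    forall (m : nat) (u v : 'I_m -> R),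
      (forall i, t0 <= u i /\ u i <= v i /\ v i <= t1) ->
      trivIset [set: 'I_m] (fun i => `]u i, v i[%classic) ->
      \sum_(i < m) (v i - u i) < d ->
      \sum_(i < m) enorm (phi (v i) - phi (u i)) < e.

Definition caputo_int t0 a phi : R -> 'cV[R]_n :=
  frac_int t0 (1 - a) (fun s => phi s - phi t0).

(* Derivatives are relative to [t0, t1], hence one-sided at t0 and t1. *)
Definition caputo_quot t0 a phi t (s : R) : 'cV[R]_n :=
  (s - t)^-1 *: (caputo_int t0 a phi s - caputo_int t0 a phi t).

Definition caputo_defined t0 t1 a phi t : Prop :=
  cvg (caputo_quot t0 a phi t s @[s --> within `[t0, t1] t^']).

(* Meaningful only at the points t where caputo_defined holds. *)
Definition caputo t0 t1 a phi t : 'cV[R]_n :=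
  lim (caputo_quot t0 a phi t s @[s --> within `[t0, t1] t^']).

Definition caputo_cont t0 t1 a phi t : Prop :=
  caputo_defined t0 t1 a phi t /\
  caputo t0 t1 a phi s @[s --> within `[t0, t1] (nbhs t)] -->
    caputo t0 t1 a phi t.

Definition PCalpha t0 t1 a phi : Prop :=
  [/\ {within `[t0, t1], continuous phi},
      abs_continuous t0 t1 (caputo_int t0 a phi)
    & exists S : seq R,
      [/\ forall t, t \in S -> t0 < t < t1,
          forall t, t0 <= t <= t1 -> t \notin S -> caputo_cont t0 t1 a phi t
        & forall t, t \in S ->
            cvg (caputo t0 t1 a phi s @[s --> t^'-]) /\
            cvg (caputo t0 t1 a phi s @[s --> t^'+])]].

Definition caputo_graph t0 t1 a phi : set (R * 'cV[R]_n * 'cV[R]_n) :=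
  [set p | p.1.2 = phi p.1.1 /\
    ((t0 <= p.1.1 <= t1 /\ caputo_defined t0 t1 a phi p.1.1 /\
        p.2 = caputo t0 t1 a phi p.1.1) \/
     (t0 < p.1.1 < t1 /\ ~ caputo_cont t0 t1 a phi p.1.1 /\
        (caputo t0 t1 a phi s @[s --> p.1.1^'-] --> p.2 \/
         caputo t0 t1 a phi s @[s --> p.1.1^'+] --> p.2)))].

End FractionalCalculus.

Section PartialDerivatives.
Variables (R : realType) (n : nat).
Local Notation V := 'cV[R]_n.

Definition partially_derivable (W : normedModType R) (f : V -> W) (v : V) :=
  forall i : 'I_n, derivable f v (delta_mx i ord0).

Definition grad (f : V -> R) (v : V) : V := \col_i 'D_(delta_mx i ord0) f v.

Definition jac (F : V -> V) (v : V) : 'M[R]_n :=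
  \matrix_(i, j) ('D_(delta_mx j ord0) F v) i ord0.

Definition C2_on (U : set V) (l : V -> R) : Prop :=
  [/\ forall v, U v ->
        partially_derivable l v /\ partially_derivable (grad l) v,
      {within U, continuous l},
      {within U, continuous (grad l)}
    & {within U, continuous (jac (grad l))}].

Variable L : R -> V -> V -> R.

Definition L_x t x y : V := grad (fun x' => L t x' y) x.
Definition L_y t x y : V := grad (fun y' => L t x y') y.
Definition L_xx t x y : 'M[R]_n := jac (fun x' => L_x t x' y) x.
Definition L_xy t x y : 'M[R]_n := jac (fun y' => L_x t x y') y.
Definition L_yy t x y : 'M[R]_n := jac (fun y' => L_y t x y') y.

(* All the partial derivatives exist on the set A of triples (t, x, y), and
   L, L_x, L_y, L_xx, L_xy, L_yy are jointly continuous on A. *)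
Definition lagrangian_C2_on (A : set (R * V * V)) : Prop :=
  (forall t x y, A (t, x, y) ->
     [/\ partially_derivable (fun x' => L t x' y) x,
         partially_derivable (fun y' => L t x y') y,
         partially_derivable (fun x' => L_x t x' y) x,
         partially_derivable (fun y' => L_x t x y') y
       & partially_derivable (fun y' => L_y t x y') y]) /\
  [/\ {within A, continuous (fun p => L p.1.1 p.1.2 p.2)},
      {within A, continuous (fun p => L_x p.1.1 p.1.2 p.2)},
      {within A, continuous (fun p => L_y p.1.1 p.1.2 p.2)},
      {within A, continuous (fun p => L_xx p.1.1 p.1.2 p.2)} &
      {within A, continuous (fun p => L_xy p.1.1 p.1.2 p.2)} /\
      {within A, continuous (fun p => L_yy p.1.1 p.1.2 p.2)}].

End PartialDerivatives.

Section Problem.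
Variables (R : realType) (n : nat) (t0 t1 : R) (x1 : 'cV[R]_n) (a b : R).
Variables (L : R -> 'cV[R]_n -> 'cV[R]_n -> R) (l : 'cV[R]_n -> R).

Definition cost (x : R -> 'cV[R]_n) : R :=
  \int[lebesgue_measure]_(t in `[t0, t1])
     ((t1 - t) `^ (b - 1) * L t (x t) (caputo t0 t1 a x t)) + l (x t0).

Definition admissible (x : R -> 'cV[R]_n) : Prop :=
  PCalpha t0 t1 a x /\ x t1 = x1.

Definition weak_dist (x x0 : R -> 'cV[R]_n) : \bar R :=
  (ereal_sup [set (enorm (x t - x0 t))%:E | t in `[t0, t1]] +
   ereal_sup [set (enorm (caputo t0 t1 a (fun s => x s - x0 s)%R t))%:E |
     t in `[t0, t1] `&` [set t | caputo_defined t0 t1 a (fun s => x s - x0 s)%R t]])%E.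

Definition weak_local_min (x0 : R -> 'cV[R]_n) : Prop :=
  admissible x0 /\
  exists2 d : R, 0 < d &
    forall x, admissible x -> (weak_dist x x0 < d%:E)%E -> cost x0 <= cost x.

End Problem.

(* Main.v *)
(** Suppose <P(ts) r, r> < 0.  Since x(t0) is free, x0 may be varied by
    +- lam (u - u(t1)) r, where u(t) = (t - ts)_+^a - (t - ts - e)_+^a.  By
    homogeneity of the Beta integral, the fractional integral of order 1 - a of
    u is a multiple K of the ramp (t - ts)_+ - (t - ts - e)_+, so the Caputo
    derivative of the variation is lam K r on ]ts, ts + e[ and 0 elsewhere.
    In the second difference J(x+) + J(x-) - 2 J(x0) >= 0 the first-order terms
    cancel; the L_yy term is at most - c lam^2 e, while all the others are
    bounded by lam^2 (e^(1 + a) + e^2) up to a constant, because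
    |u - u(t1)| <= e^a and the weighted integral of |u - u(t1)| is O(e).
    Small e gives a contradiction. *)
Require Import Defs.
From HB Require Import structures.
From mathcomp Require Import all_boot all_order all_algebra.
From mathcomp Require Import all_classical all_reals all_analysis.
From mathcomp Require Import measurable_realfun ring lra.

Set Implicit Arguments.
Unset Strict Implicit.
Unset Printing Implicit Defensive.

Import Order.TTheory GRing.Theory Num.Theory.
Import numFieldNormedType.Exports.

Local Open Scope classical_set_scope.
Local Open Scope ring_scope.

(** The Caputo derivative is nonlocal: a perturbation supported near [ts] does not have its
    derivative supported there. So the derivative is prescribed as a pulse, and u is, up to a
    factor, the fractional integral of order a of that pulse. The price is a tail beyond ts + e. It
    is O(e) away from [ts], but it meets the weight (t1 - t)^(b - 1), which is singular at [t1] when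
    b < 1; near [ts] the weight is bounded, but u is pointwise only O(e^a). Cutting midway between
    [ts] and [t1] separates the two difficulties. The parameters have distinct roles. The width e is
    fixed first, from constants attached to x0 alone. Then lam is taken small, depending on e, to
    stay in the weak neighborhood and in the tubes where L is controlled. Every estimate is
    homogeneous of degree 2 in lam, which therefore divides out. Only coordinate partial derivatives
    are given, and the mixed one at hand is [L_xy], the y-derivative of [L_x]. This dictates how
    second differences are split: y is moved alone at x0(t), and the remaining increments move x. *)

(** * Affine changes of variable in Lebesgue integrals *)

Section AffineChange.
Context {R : realType}.
Local Notation mu := (@lebesgue_measure R).
Implicit Types (c d : R).

Definition affine c d : R -> R := fun x => c * x + d.
Arguments affine : simpl never.

Lemma measurable_affine c d : measurable_fun [set: R] (affine c d).
Proof.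
apply: measurable_funD; last exact: measurable_cst.
exact: measurable_funM.
Qed.

Lemma affine_preimage_itv c d (a b : R) : 0 < c ->
  affine c d @^-1` `]a, b]%classic = `](a - d) / c, (b - d) / c]%classic.
Proof.
move=> c0; apply/seteqP; split => x /=; rewrite !in_itv/= /affine.
  by rewrite ltr_pdivrMr// ler_pdivlMr// ltrBlDr lerBrDr (mulrC x).
by rewrite ltr_pdivrMr// ler_pdivlMr// ltrBlDr lerBrDr (mulrC x).
Qed.

(** Lebesgue measure is determined by its values on half-open intervals, where it is compared with
    [c] times its pushforward. *)
Lemma lebesgue_measure_affine c d (A : set R) : 0 < c -> measurable A ->
  (mu A = c%:E * mu (affine c d @^-1` A))%E.
Proof.
move=> c0 mA.
pose nu : {measure set (measurableTypeR R) -> \bar R} :=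
  mscale (NngNum (ltW c0))
    (pushforward mu (affine c d : measurableTypeR R -> measurableTypeR R)).
have := @lebesgue_measure_unique R (nu (measurable_affine c d)).
move=> /(_ _ A mA) -> //=.
move=> _ [[a b] _ <-]; rewrite /nu /= /mscale /pushforward/=.
rewrite /pushforward affine_preimage_itv//.
rewrite !lebesgue_measure_itv/= !lte_fin ltr_pM2r ?invr_gt0// ltrD2r.
case: ifPn => _; last by rewrite mule0.
rewrite -!EFinB -EFinM; congr (_%:E).
by rewrite -mulrBl mulrCA divff ?gt_eqF// mulr1 opprB addrA subrK.
Qed.

Lemma ge0_integral_affine c d (D : set R) (f : R -> \bar R) : 0 < c ->
  measurable D -> measurable_fun D f -> (forall x, D x -> 0 <= f x)%E ->
  (\int[mu]_(x in D) f x =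
   c%:E * \int[mu]_(x in affine c d @^-1` D) f (affine c d x))%E.
Proof.
move=> c0 mD mf f0.
rewrite -(@ge0_integral_pushforward _ _ (measurableTypeR R) (measurableTypeR R)
  _ _ (measurable_affine c d) mu D f)//; last first.
  by move=> x; rewrite inE; exact: f0.
rewrite -(@ge0_integral_mscale _ (measurableTypeR R) R
  (pushforward mu (affine c d : measurableTypeR R -> measurableTypeR R))
  D mD (NngNum (ltW c0)) f mf f0); first exact: measurable_affine.
move=> ?; apply: eq_measure_integral => A mA _.
exact: lebesgue_measure_affine.
Qed.

Lemma Rintegral_affine c d (D : set R) (f : R -> R) : 0 < c ->
  measurable D -> measurable_fun D f -> (forall x, D x -> 0 <= f x) ->
  \int[mu]_(x in D) f x =
   c * \int[mu]_(x in affine c d @^-1` D) f (affine c d x).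
Proof.
move=> c0 mD mf f0; rewrite /Rintegral (ge0_integral_affine d c0)//.
(* When the integral is infinite both sides are 0, because [fine] sends [+oo] to 0. *)
- set I := (\int[mu]_(x in _) _)%E.
  have : (0 <= I)%E by apply: integral_ge0 => x Dx; rewrite lee_fin f0.
  by case: I => [r| |]//= _; rewrite gt0_muley ?lte_fin//= mulr0.
- exact/measurable_EFinP.
Qed.

Lemma integrable_affine c d (D : set R) (f : R -> R) : 0 < c ->
  measurable D -> mu.-integrable D (EFin \o f) ->
  mu.-integrable (affine c d @^-1` D) (EFin \o (f \o affine c d)).
Proof.
move=> c0 mD /integrableP[mf If].
have mf' : measurable_fun D f by exact/measurable_EFinP.
apply/integrableP; split.
  apply/measurable_EFinP.
  apply: (measurable_comp mD) => //; last exact: measurable_funTS (measurable_affine c d).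
  by move=> _ [x /= Dx <-].
move: If; rewrite (ge0_integral_affine d c0)//; last exact: measurableT_comp.
set I := (\int[mu]_(x in _) _)%E.
move=> If; rewrite ltNge leye_eq; apply/negP => /eqP IE.
by move: If; rewrite /= (_ : I = +oo%E)// gt0_muley ?lte_fin// ltxx.
Qed.

(** Reflection complements the affine maps of positive slope; together they carry the singularity of
    s^p at 0 to that of (t - s)^p at [t]. *)
Lemma integrable_opp (D : set R) (f : R -> R) :
  measurable D -> mu.-integrable D (EFin \o f) ->
  mu.-integrable (-%R @^-1` D) (EFin \o (f \o -%R)).
Proof.
move=> mD /integrableP[mf If].
have mf' : measurable_fun D f by exact/measurable_EFinP.
have mN : measurable_fun [set: R] (-%R : R -> R) by exact: oppr_measurable.
apply/integrableP; split.
  apply/measurable_EFinP; apply: (measurable_comp mD) => //.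
    by move=> _ [x /= Dx <-].
apply: le_lt_trans If.
rewrite -(@ge0_integral_pushforward _ _ (measurableTypeR R) (measurableTypeR R)
  _ _ mN mu D (fun x => `|(f x)%:E|%E))//; last exact: measurableT_comp.
by rewrite le_eqVlt; apply/orP; left; apply/eqP/eq_measure_integral => A mA _;
  exact: lebesgue_measureN.
Qed.

End AffineChange.

(** * Integrability of power singularities and positivity of the Gamma function *)

Section PowerIntegrability.
Context {R : realType}.
Local Notation mu := (@lebesgue_measure R).
Implicit Types (a b p t : R).

Lemma powR_continuous_at p : {in `]0, +oo[, continuous (fun x : R => x `^ p)}.
Proof.
move=> x; rewrite in_itv/= andbT => x0.
apply: differentiable_continuous; apply/derivable1_diffP.
by apply: derivable_powR; rewrite in_itv/= andbT.
Qed.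

(** The bound is independent of [a], which allows the lower limit to tend to the singularity at
    0. *)
Lemma integral_powR_le a b p : 0 < a -> a < b -> -1 < p ->
  (\int[mu]_(s in `[a, b]) (s `^ p)%:E <= (b `^ (p + 1) / (p + 1))%:E)%E.
Proof.
move=> a0 ab p1; have p10 : 0 < p + 1 by lra.
pose F (x : R) : R := x `^ (p + 1) / (p + 1).
have dF (x : R) : 0 < x -> is_derive x 1 F (x `^ p).
  move=> x0; rewrite /F.
  have := is_deriveM (is_derive1_powR (p + 1) x0) (is_derive_cst (p + 1)^-1 x 1).
  rewrite /= addrK scaler0 add0r /GRing.scale/= mulrA mulVf ?mul1r//.
  by rewrite gt_eqF.
have cF (x : R) : 0 < x -> {for x, continuous F}.
  move=> x0; apply: differentiable_continuous; apply/derivable1_diffP.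
  by have [] := dF _ x0.
have b0 : 0 < b by exact: lt_trans ab.
rewrite (@continuous_FTC2 _ _ F)//.
- by rewrite -EFinB lee_fin lerBlDr lerDl divr_ge0 ?powR_ge0 ?ltW.
- apply/continuous_within_itvP => //; split.
  + move=> x; rewrite in_itv/= => /andP[ax _].
    by apply: powR_continuous_at; rewrite in_itv/= andbT (lt_trans a0).
  + apply: cvg_at_right_filter.
    by apply: powR_continuous_at; rewrite in_itv/= andbT.
  + apply: cvg_at_left_filter.
    by apply: powR_continuous_at; rewrite in_itv/= andbT.
- split.
  + move=> x; rewrite in_itv/= => /andP[ax _].
    by have [] := dF x (lt_trans a0 ax).
  + by apply: cvg_at_right_filter; exact: cF.
  + by apply: cvg_at_left_filter; exact: cF.
- move=> x; rewrite in_itv/= => /andP[ax _]; rewrite derive1E.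
  by have [_ ->] := dF x (lt_trans a0 ax).
Qed.

Lemma integrable_powR b p : -1 < p ->
  mu.-integrable `[0, b] (EFin \o (fun s => s `^ p)).
Proof.
move=> p1; have mp (D : set R) : measurable_fun D (fun s : R => s `^ p).
  by apply: measurable_funTS; exact: measurable_powR.
apply/integrableP; split; first by apply/measurable_EFinP; exact: mp.
under eq_integral do rewrite /= ger0_norm ?powR_ge0//.
rewrite -integral_itv_obnd_cbnd; last by apply/measurable_EFinP; exact: mp.
rewrite itv_open_bnd_bigcup.
set F := fun n : nat => [set` Interval (BLeft (0 + n.+1%:R^-1)) (BRight b)].
apply: (@le_lt_trans _ _ (b `^ (p + 1) / (p + 1))%:E); last exact: ltry.
have ndF : nondecreasing_seq F.
  move=> m n mn; rewrite subsetEset => x; rewrite /F/= !in_itv/= !add0r.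
  move=> /andP[mx ->]; rewrite andbT (le_trans _ mx)// lef_pV2 ?posrE//.
  by rewrite ler_nat.
have cF := @ge0_nondecreasing_set_cvg_integral _ (measurableTypeR R) R F
  (fun s => (s `^ p)%:E) mu ndF.
have {}cF : (\int[mu]_(x in F i) (x `^ p)%:E @[i --> \oo] -->
    \int[mu]_(x in \bigcup_i F i) (x `^ p)%:E)%E.
  apply: cF.
  - by move=> i; exact: measurable_itv.
  - by move=> i; apply/measurable_EFinP; exact: mp.
  - by move=> i x _; rewrite lee_fin powR_ge0.
rewrite -(cvg_lim _ cF)//; apply: lime_le; first by apply/cvg_ex; eexists; exact: cF.
apply: nearW => n; rewrite /F add0r.
(* Otherwise the truncated interval is empty or a single point. *)
have [nb|bn] := ltP n.+1%:R^-1 b; first by apply: integral_powR_le.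
rewrite (@integral_Sset1 _ _ _ n.+1%:R^-1).
  by rewrite lee_fin divr_ge0 ?powR_ge0//; lra.
by move=> x /=; rewrite in_itv/= => /andP[nx xb]; apply/eqP;
  rewrite eq_le nx (le_trans xb bn).
Qed.

Lemma integrable_subr_powR a t p : -1 < p ->
  mu.-integrable `[a, t] (EFin \o (fun s => (t - s) `^ p)).
Proof.
move=> p1.
have -> : (fun s => (t - s) `^ p) = ((fun s : R => s `^ p) \o affine 1 t) \o -%R.
  by apply/funext => x /=; rewrite /affine mul1r addrC.
have -> : `[a, t]%classic = -%R @^-1` (affine 1 t @^-1` `[0, t - a]%classic).
  by apply/seteqP; split => x /=; rewrite /affine !in_itv/= => /andP[? ?];
    apply/andP; split; lra.
apply: integrable_opp.
  by rewrite -[X in measurable X]setTI; exact: measurable_affine.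
by apply: integrable_affine => //; exact: integrable_powR.
Qed.

(** Source of the strict lower bounds for [Gamma], [beta_cst] and the weighted pulse. Integrability
    matters: a divergent integral would have the real value 0. *)
Lemma Rintegral_ge_cst (D A : set R) (f : R -> R) (c : R) :
  measurable D -> measurable A -> A `<=` D -> (mu A < +oo)%E ->
  mu.-integrable D (EFin \o f) ->
  (forall x, D x -> 0 <= f x) -> (forall x, A x -> c <= f x) ->
  c * fine (mu A) <= \int[mu]_(x in D) f x.
Proof.
move=> mD mA AD Afin fi f0 fc; rewrite -Rintegral_cst//.
have fiA : mu.-integrable A (EFin \o f) by exact: integrableS fi.
apply: (@le_trans _ _ (\int[mu]_(x in A) f x)).
  apply: le_Rintegral => //.
  apply: measurable_bounded_integrable => //.
  exact: bounded_cst.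
rewrite fine_le ?integrable_fin_num//.
apply: ge0_subset_integral => //; first by case/integrableP : fi.
Qed.

Lemma Gamma_gt0 a : 0 < a <= 1 -> 0 < Gamma a.
Proof.
move=> /andP[a0 a1]; rewrite /Gamma.
have mf (D : set R) : measurable_fun D (fun s : R => s `^ (a - 1) * expR (- s)).
  apply: measurable_funTS; apply: measurable_funM; first exact: measurable_powR.
  by apply: measurableT_comp => //; exact: oppr_measurable.
(* The integrand is dominated by s^(a - 1) on [0, 1] plus the exponential density of rate 1, since
   s^(a - 1) <= 1 beyond 1. *)
have fi : mu.-integrable `]0, +oo[
    (EFin \o (fun s : R => s `^ (a - 1) * expR (- s))).
  have i1 : mu.-integrable `]0, +oo[
      (EFin \o ((fun s : R => s `^ (a - 1)) \_ `[0, 1])).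
    apply: (@integrableS _ _ _ _ setT) => //; rewrite -restrict_EFin.
    by apply/(integrable_mkcond _ _).1 => //; apply: integrable_powR; lra.
  have i2 : mu.-integrable `]0, +oo[ (EFin \o exponential_pdf (1 : R)).
    by apply: (@integrableS _ _ _ _ setT) => //; exact: integrable_exponential_pdf.
  apply: le_integrable (integrableD _ i1 i2) => //; first by apply/measurable_EFinP; exact: mf.
  move=> x /=; rewrite in_itv/= andbT => x0.
  rewrite lee_fin !ger0_norm; last 2 first.
  - rewrite addr_ge0 ?exponential_pdf_ge0//.
    by rewrite patchE; case: ifPn => _; rewrite ?powR_ge0.
  - by rewrite mulr_ge0 ?powR_ge0 ?expR_ge0.
  rewrite exponential_pdfE; last exact: ltW.
  rewrite mul1r mulN1r patchE.
  have [x1|x1] := leP x 1.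
    rewrite ifT; last by rewrite inE/= in_itv/= ltW.
    rewrite (@le_trans _ _ (x `^ (a - 1)))// ?lerDl ?expR_ge0//.
    by rewrite ler_piMr ?powR_ge0// expR_le1 oppr_le0 ltW.
  rewrite (@le_trans _ _ (expR (- x)))//; last first.
    by rewrite lerDr; case: ifPn => _; rewrite ?powR_ge0.
  rewrite ler_piMl ?expR_ge0//.
  have -> : a - 1 = - (1 - a) by lra.
  rewrite powRN invf_le1 ?powR_gt0//.
  by rewrite -[leLHS](powRr0 x) ler_powR//; [exact: ltW|lra].
have := @Rintegral_ge_cst `]0, +oo[ `[1, 2] _ (2 `^ (a - 1) * expR (- 2)) _ _ _ _ fi.
rewrite lebesgue_measure_itv/= lte_fin ltr1n/= => H.
apply: lt_le_trans (H _ _ _ _ _ _) => //.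
- by move=> x /=; rewrite !in_itv/= andbT; lra.
- exact: ltry.
- by move=> x _; rewrite mulr_ge0 ?powR_ge0 ?expR_ge0.
- move=> x /=; rewrite in_itv/= => /andP[x1 x2].
  rewrite ler_pM ?powR_ge0 ?expR_ge0//; last by rewrite ler_expR lerN2.
  have -> : a - 1 = - (1 - a) by lra.
  rewrite !powRN lef_pV2 ?posrE ?powR_gt0//; [|lra].
  by apply: ge0_ler_powR; rewrite ?nnegrE; lra.
Qed.

End PowerIntegrability.

(** * Bounded multiples of integrable weights and comparison off null sets *)

Section BoundedMultiples.
Context {R : realType}.
Local Notation mu := (@lebesgue_measure R).

Lemma integrable_mul_bounded (D : set R) (w f : R -> R) (M : R) :
  measurable D -> mu.-integrable D (EFin \o w) -> measurable_fun D f ->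
  (forall x, D x -> `|f x| <= M) ->
  mu.-integrable D (EFin \o (fun x => w x * f x)).
Proof.
move=> mD iw mf fM.
have iMw : mu.-integrable D (fun x => M%:E * (EFin \o w) x)%E.
  exact: integrableZl.
apply: le_integrable iMw => //.
  apply/measurable_EFinP; apply: measurable_funM => //.
  by apply/measurable_EFinP; exact: measurable_int iw.
move=> x Dx /=; rewrite lee_fin !normrM mulrC ler_wpM2r//.
by rewrite (le_trans (fM _ Dx))// ler_norm.
Qed.

Lemma le_Rintegral_off_null (D N : set R) (f g : R -> R) :
  measurable D -> measurable N -> mu N = 0%E ->
  mu.-integrable D (EFin \o f) -> mu.-integrable D (EFin \o g) ->
  (forall x, D x -> ~ N x -> f x <= g x) ->
  \int[mu]_(x in D) f x <= \int[mu]_(x in D) g x.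
Proof.
move=> mD mN N0 fi gi fg; rewrite /Rintegral.
have mN' : measurable (N : set (measurableTypeR R)) by [].
have mD' : measurable (D : set (measurableTypeR R)) by [].
have H := @negligible_integral _ (measurableTypeR R) R mu D N.
rewrite (H _ mN' mD' fi N0) (H _ mN' mD' gi N0).
apply: le_Rintegral.
- exact: measurableD.
- by apply: integrableS fi => //; exact: measurableD.
- by apply: integrableS gi => //; exact: measurableD.
- by move=> x [Dx Nx]; exact: fg.
Qed.

End BoundedMultiples.

(** * Hölder and Lipschitz estimates for truncated powers *)

Section PositivePartPower.
Context {R : realType}.
Local Notation mu := (@lebesgue_measure R).
Implicit Types (a e t x y : R).

Definition ppow a t : R := Num.max t 0 `^ a.

Lemma ppow_ge0 a t : 0 <= ppow a t. Proof. exact: powR_ge0. Qed.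

Lemma ppow_le0E a t : 0 < a -> t <= 0 -> ppow a t = 0.
Proof. by move=> a0 t0; rewrite /ppow max_r// powR0// gt_eqF. Qed.

Lemma ppow_ge0E a t : 0 <= t -> ppow a t = t `^ a.
Proof. by move=> t0; rewrite /ppow max_l. Qed.

Lemma ppow_homo a x y : 0 <= a -> x <= y -> ppow a x <= ppow a y.
Proof.
move=> a0 xy; rewrite /ppow ge0_ler_powR// ?nnegrE.
- by rewrite le_max lexx orbT.
- by rewrite le_max lexx orbT.
- by rewrite ge_max !le_max xy lexx/= orbT.
Qed.

(** For 0 < u <= z the ratio u/z is at most (u/z)^a because a <= 1. Take z = x + y and add the cases
    u = x and u = y. *)
Lemma powR_subadd a x y : 0 < a <= 1 -> 0 <= x -> 0 <= y ->
  (x + y) `^ a <= x `^ a + y `^ a.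
Proof.
move=> /andP[a0 a1]; have an0 : a != 0 by rewrite gt_eqF.
rewrite le_eqVlt => /predU1P[<-|x0]; first by rewrite add0r powR0// add0r.
rewrite le_eqVlt => /predU1P[<-|y0]; first by rewrite addr0 powR0// addr0.
have z0 : 0 < x + y by exact: addr_gt0.
have H (u : R) : 0 < u -> u <= x + y -> (x + y) `^ a * (u / (x + y)) <= u `^ a.
  move=> u0 uz; rewrite -{2}[u](divfK (lt0r_neq0 z0)) [_ / _ * _]mulrC.
  rewrite powRM; [|exact: ltW|by rewrite divr_ge0// ltW].
  rewrite ler_pM2l ?powR_gt0//.
  by rewrite ger1_powR// divr_gt0//= ler_pdivrMr// mul1r.
apply: le_trans (lerD (H x x0 _) (H y y0 _)); last 2 first.
- by rewrite lerDl ltW.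
- by rewrite lerDr ltW.
by rewrite -mulrDr -mulrDl divff ?gt_eqF// mulr1.
Qed.

Lemma ppow_holder a t e : 0 < a <= 1 -> 0 <= e ->
  ppow a (t + e) - ppow a t <= e `^ a.
Proof.
move=> a01 e0; have /andP[a0 a1] := a01; rewrite lerBlDl.
have [t0|t0] := leP t 0.
  rewrite (ppow_le0E a0 t0) add0r -ppow_ge0E//; apply: ppow_homo; lra.
have t0' := ltW t0.
by rewrite !ppow_ge0E ?addr_ge0// powR_subadd.
Qed.

(** Factor out t^a and use (1 + e/t)^a <= 1 + e/t. Away from the kink an increment is thus O(e),
    against e^a near it. *)
Lemma ppow_lipschitz a t e : 0 < a <= 1 -> 0 < t -> 0 <= e ->
  ppow a (t + e) - ppow a t <= t `^ (a - 1) * e.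
Proof.
move=> /andP[a0 a1] t0 e0; rewrite lerBlDl !ppow_ge0E ?addr_ge0//; [|exact: ltW..].
have -> : t + e = t * (1 + e / t) by rewrite mulrDr mulr1 mulrCA divff ?mulr1// gt_eqF.
have et : 0 <= e / t by rewrite divr_ge0// ltW.
rewrite powRM; [|exact: ltW|lra].
rewrite (@le_trans _ _ (t `^ a * (1 + e / t)))//.
  by rewrite ler_wpM2l ?powR_ge0// ler1_powR//; lra.
rewrite mulrDr mulr1 lerD2l -(@mulr_powRB1 _ t a)//; last exact: ltW.
by rewrite mulrCA [t * _ * _]mulrAC divff ?gt_eqF// mul1r mulrC.
Qed.

Lemma ppow_continuous a : 0 < a <= 1 -> continuous (ppow a).
Proof.
move=> a01 t; have /andP[a0 a1] := a01; apply/cvgrPdist_le => e e0.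
have /cvgrPdist_lt/(_ e e0) := powR_cvg0 a0.
rewrite near_withinE => /nbhs_ballP[d /= d0 dP].
apply/nbhs_ballP; exists d => //= s; rewrite /ball/= => ts.
have H (x y : R) : x <= y -> `|x - y| < d -> `|ppow a y - ppow a x| <= e.
  rewrite le_eqVlt => /predU1P[->|xy xyd]; first by rewrite !subrr normr0 ltW.
  rewrite ger0_norm; last by rewrite subr_ge0 ppow_homo// ltW.
  have -> : y = x + (y - x) by lra.
  have xy0 : 0 <= y - x by rewrite subr_ge0 ltW.
  apply: le_trans (ppow_holder _ a01 xy0) _.
  have := dP (y - x); rewrite /ball/= sub0r normrN distrC => /(_ xyd).
  rewrite subr_gt0 => /(_ xy); by rewrite sub0r normrN ger0_norm ?powR_ge0// => /ltW.
have [st|/ltW st] := leP s t; first by apply: H => //; rewrite distrC.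
by rewrite distrC; exact: H.
Qed.

Lemma measurable_ppow a (D : set R) (c : R) : 0 < a <= 1 ->
  measurable_fun D (fun s => ppow a (s - c)).
Proof.
move=> a01; apply: measurable_funTS.
apply: measurableT_comp.
  by apply: continuous_measurable_fun; exact: ppow_continuous.
exact: measurable_funB.
Qed.

End PositivePartPower.

(** * The fractional integral of a truncated power *)

Section FractionalIntegralOfPower.
Context {R : realType}.
Local Notation mu := (@lebesgue_measure R).
Implicit Types (a c e m t ts : R).

(* The Beta value B(1 - a, a + 1), with the exponent 1 - a - 1 as in [frac_int]. *)
Definition beta_cst a : R :=
  \int[mu]_(s in `[0, 1]) ((1 - s) `^ (1 - a - 1) * s `^ a).

Lemma beta_cst_gt0 a : 0 < a < 1 -> 0 < beta_cst a.
Proof.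
move=> /andP[a0 a1].
have fi : mu.-integrable `[0, 1]
    (EFin \o (fun s : R => (1 - s) `^ (1 - a - 1) * s `^ a)).
  apply: (@integrable_mul_bounded _ _ _ _ 1) => //.
  - by apply: integrable_subr_powR; lra.
  - by apply: measurable_funTS; exact: measurable_powR.
  - move=> x /=; rewrite in_itv/= => /andP[x0 x1].
    rewrite ger0_norm ?powR_ge0//; have <- : 1 `^ a = 1 :> R by rewrite powR1.
    by apply: ge0_ler_powR; rewrite ?nnegrE; lra.
have := @Rintegral_ge_cst _ `[0, 1] `[4^-1, 2^-1] _ (4^-1 `^ a) _ _ _ _ fi.
rewrite lebesgue_measure_itv/= lte_fin ifT; last by lra.
move=> H; apply: lt_le_trans (H _ _ _ _ _ _) => //=.
- by rewrite mulr_gt0 ?powR_gt0//; lra.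
- by move=> x /=; rewrite !in_itv/= => /andP[? ?]; apply/andP; split; lra.
- exact: ltry.
- by move=> x _; rewrite mulr_ge0 ?powR_ge0.
- move=> x /=; rewrite in_itv/= => /andP[x0 x1].
  have xa : 4^-1 `^ a <= x `^ a by apply: ge0_ler_powR; rewrite ?nnegrE; lra.
  rewrite (le_trans xa)// ler_peMl ?powR_ge0//.
  have -> : 1 - a - 1 = - a by lra.
  rewrite powRN invf_ge1 ?powR_gt0//; last by lra.
  apply: (@le_trans _ _ (1 `^ a)); last by rewrite powR1.
  apply: ge0_ler_powR; rewrite ?nnegrE; lra.
Qed.

(** After rescaling [c, t] to [0, 1] the factors (t - c)^(-a) and (t - c)^a cancel, so only the
    Jacobian t - c is left in front of the Beta value. *)
Lemma frac_int_ppow a t0 c t : 0 < a < 1 -> t0 <= c ->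
  \int[mu]_(s in `[t0, t]) ((t - s) `^ (1 - a - 1) * ppow a (s - c)) =
  beta_cst a * Num.max (t - c) 0.
Proof.
move=> /andP[a0 a1] t0c; have [tc|ct] := leP t c.
  rewrite max_r ?subr_le0// mulr0.
  rewrite (@eq_Rintegral _ _ _ _ _ (cst 0)); last first.
    move=> x; rewrite inE/= in_itv/= => /andP[_ xt].
    by rewrite ppow_le0E ?mulr0//; lra.
  by rewrite Rintegral_cst// mul0r.
rewrite max_l ?subr_ge0 ?(ltW ct)//.
have tc0 : 0 < t - c by rewrite subr_gt0.
have -> : \int[mu]_(s in `[t0, t]) ((t - s) `^ (1 - a - 1) * ppow a (s - c)) =
    \int[mu]_(s in `[c, t]) ((t - s) `^ (1 - a - 1) * ppow a (s - c)).
  rewrite Rintegral_mkcond [RHS]Rintegral_mkcond; apply: eq_Rintegral => x _.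
  rewrite !patchE; have [xc|cx] := ltP x c.
    rewrite [in RHS]ifF; last first.
      by apply/negbTE; rewrite notin_setE/= in_itv/= leNgt xc.
    by case: ifPn => // _; rewrite ppow_le0E ?mulr0//; lra.
  congr (if _ then _ else _); apply/idP/idP; rewrite !inE/= !in_itv/= cx/=.
    by case/andP.
  by move=> ->; rewrite andbT; exact: le_trans cx.
rewrite (Rintegral_affine c tc0)//; last 2 first.
- apply: measurable_funM; last by apply: measurable_ppow; lra.
  apply: measurable_funTS; apply: (measurableT_comp (measurable_powR _)).
  exact: measurable_funB.
- by move=> x _; rewrite mulr_ge0 ?powR_ge0 ?ppow_ge0.
rewrite mulrC; congr (_ * _); rewrite /beta_cst.
have -> : affine (t - c) c @^-1` `[c, t] = `[0, 1]%classic.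
  apply/seteqP; split => x /=; rewrite /affine !in_itv/=.
    rewrite -lerBlDr subrr pmulr_rge0// => /andP[->/=].
    by rewrite -lerBrDr -[leRHS]mulr1 ler_pM2l.
  move=> /andP[x0 x1]; rewrite lerDr mulr_ge0//=; [|exact: ltW].
  by rewrite -lerBrDr -[leRHS]mulr1 ler_pM2l.
apply: eq_Rintegral => x; rewrite inE/= in_itv/= /affine => /andP[x0 x1].
rewrite addrK ppow_ge0E ?mulr_ge0//; last exact: ltW.
have -> : t - ((t - c) * x + c) = (t - c) * (1 - x) by ring.
rewrite !powRM ?subr_ge0 ?(ltW ct)// mulrACA -powRD; last first.
  by rewrite subr_eq0 (gt_eqF ct) implybT.
have -> : 1 - a - 1 + a = 0 by ring.
by rewrite powRr0 mul1r.
Qed.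

(** A function minus its translate by [e] integrates to boundary contributions: the one at [t0] is
    dropped by sign, and the one at [m] is an integral over a window of length [e]. This gains the
    order O(e) where the pointwise bound is only e^a. *)
Lemma Rintegral_ppow_shift_le a t0 ts m e : 0 < a <= 1 ->
  t0 <= ts -> 0 <= e -> t0 + e <= m ->
  \int[mu]_(s in `[t0, m]) (ppow a (s - ts) - ppow a (s - ts - e)) <=
  e * ppow a (m - ts).
Proof.
move=> a01 t0ts e0 em; have /andP[a0 a1] := a01.
have ip c u v : mu.-integrable `[u, v] (EFin \o (fun s => ppow a (s - c))).
  apply: continuous_compact_integrable; first exact: segment_compact.
  apply: continuous_subspaceT => x.
  apply: (@continuous_comp _ _ _ (fun s : R => s - c) (ppow a)).
    by apply: cvgB => //; exact: cvg_cst.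
  exact: ppow_continuous.
under eq_Rintegral do rewrite -[_ - ts - e]addrA -opprD.
rewrite RintegralB//.
have -> : \int[mu]_(s in `[t0, m]) ppow a (s - (ts + e)) =
    \int[mu]_(s in `[t0 - e, m - e]) ppow a (s - ts).
  rewrite (Rintegral_affine e ltr01)//; last 2 first.
  - by apply: measurable_ppow.
  - by move=> x _; exact: ppow_ge0.
  rewrite mul1r; have -> : affine 1 e @^-1` `[t0, m] = `[t0 - e, m - e]%classic.
    by apply/seteqP; split => x /=; rewrite /affine mul1r !in_itv/= => /andP[? ?];
      apply/andP; split; lra.
  by apply: eq_Rintegral => x _; rewrite /affine; congr ppow; ring.
have H : \int[mu]_(s in `[t0, m - e]) ppow a (s - ts) <=
    \int[mu]_(s in `[t0 - e, m - e]) ppow a (s - ts).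
  rewrite /Rintegral fine_le ?integrable_fin_num//; [exact: ip|exact: ip|].
  apply: ge0_subset_integral => //.
  - by apply/measurable_EFinP; exact: measurable_ppow.
  - by move=> x _; rewrite lee_fin ppow_ge0.
  - by move=> x /=; rewrite !in_itv/= => /andP[? ?]; apply/andP; split; lra.
apply: (@le_trans _ _ (\int[mu]_(s in `[t0, m]) ppow a (s - ts) -
   \int[mu]_(s in `[t0, m - e]) ppow a (s - ts))); first by rewrite lerD2l lerN2.
rewrite Rintegral_itvB//; [|rewrite bnd_simp; lra..].
have muI : (mu `](m - e)%R, m]%classic < +oo)%E.
  by rewrite lebesgue_measure_itv/=; case: ifP => _; exact: ltry.
apply: (@le_trans _ _ (\int[mu]_(s in `]m - e, m]) ppow a (m - ts))).
  apply: le_Rintegral => //.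
  - apply: integrableS (ip ts (m - e) m) => //.
    by move=> x /=; rewrite !in_itv/= => /andP[/ltW -> ->].
  - apply: measurable_bounded_integrable => //; last exact: bounded_cst.
  - move=> x /=; rewrite in_itv/= => /andP[_ xm].
    by apply: ppow_homo; [exact: ltW|lra].
have muE : fine (mu `](m - e)%R, m]%classic) <= e.
  by rewrite lebesgue_measure_itv/= lte_fin; case: ifP => _ //=; rewrite subKr.
rewrite Rintegral_cst// mulrC; apply: ler_wpM2r; first exact: ppow_ge0.
exact: muE.
Qed.

End FractionalIntegralOfPower.

(** * Comparison of the Euclidean norm with the maximum norm of matrices *)

Section EuclideanNorm.
Context {R : realType} {n : nat}.
Implicit Types u v : 'cV[R]_n.

Lemma coord_le_norm (m k : nat) (M : 'M[R]_(m, k)) i j : `|M i j| <= `|M|.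
Proof.
rewrite [leRHS]/Num.norm/= mx_normrE.
exact: (le_bigmax _ (fun ij => `|M ij.1 ij.2|) (i, j)).
Qed.

Lemma coord_le_enorm u i : `|u i ord0| <= enorm u.
Proof.
rewrite /enorm -sqrtr_sqr ler_wsqrtr// /dotp (bigD1 i)//= -expr2 lerDl.
by rewrite sumr_ge0// => j _; rewrite -expr2 sqr_ge0.
Qed.

Lemma enorm_le_sum u : enorm u <= \sum_i `|u i ord0|.
Proof.
have H0 : 0 <= \sum_i `|u i ord0| by exact: sumr_ge0.
rewrite /enorm -[leRHS]ger0_norm// -sqrtr_sqr ler_wsqrtr// /dotp expr2.
rewrite mulr_suml ler_sum// => i _.
rewrite (le_trans (ler_norm _))// normrM ler_wpM2l// (bigD1 i)//= lerDl.
exact: sumr_ge0.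
Qed.

Lemma enorm_le_norm u : enorm u <= n%:R * `|u|.
Proof.
rewrite (le_trans (enorm_le_sum u))// mulr_natl -[X in _ *+ X]card_ord.
by rewrite -sumr_const ler_sum// => i _; exact: coord_le_norm.
Qed.

(** A coordinatewise triangle inequality; the factor n is harmless for absolute continuity, which is
    insensitive to constants. *)
Lemma enorm_add_le u v : enorm (u + v) <= n%:R * (enorm u + enorm v).
Proof.
rewrite (le_trans (enorm_le_sum _))// mulr_natl -[X in _ *+ X]card_ord.
rewrite -sumr_const ler_sum// => i _; rewrite mxE (le_trans (ler_normD _ _))//.
by rewrite lerD// coord_le_enorm.
Qed.

Lemma enorm_ge0 u : 0 <= enorm u. Proof. exact: sqrtr_ge0. Qed.

Lemma enormZ c u : enorm (c *: u) = `|c| * enorm u.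
Proof.
rewrite /enorm -sqrtr_sqr -sqrtrM ?sqr_ge0//; congr Num.sqrt.
rewrite /dotp mulr_sumr; apply: eq_bigr => i _; rewrite !mxE; ring.
Qed.

End EuclideanNorm.

(** * Punctured and one-sided neighborhoods relative to a segment *)

Section RelativeFilters.
Context {R : realType}.
Implicit Types (t ts e : R) (S : seq R).

(** Properness makes the limit defining [caputo] unique, also at the end points, where only one side
    of [t] is available. *)
Lemma within_dnbhs_proper t0 t1 t : t0 < t1 -> t0 <= t <= t1 ->
  ProperFilter (within `[t0, t1] t^').
Proof.
move=> t01 /andP[t0t tt1].
apply: Build_ProperFilter_ex => P.
rewrite /within/= /dnbhs => /nbhs_ballP[e /= e0 eP].
have [tt1'|t1t] := ltP t t1.
  exists (Num.min t1 (t + e / 2)); apply: eP => /=.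
  - rewrite /ball/= distrC ger0_norm; last by rewrite subr_ge0 le_min tt1; lra.
    by rewrite ltrBlDr gt_min; apply/orP; right; lra.
  - by rewrite gt_eqF// lt_min tt1'/=; lra.
  - rewrite in_itv/= le_min ge_min lexx/= andbT (ltW t01)/=; lra.
exists (Num.max t0 (t - e / 2)); apply: eP => /=.
- rewrite /ball/= ger0_norm; last by rewrite subr_ge0 ge_max t0t; lra.
  by rewrite ltrBlDr -ltrBlDl lt_max; apply/orP; right; lra.
- rewrite lt_eqF// gt_max; apply/andP; split; lra.
- by rewrite in_itv/= le_max lexx/= ge_max (ltW t01)/=; lra.
Qed.

Lemma near_notin S t : \forall s \near t, s != t -> s \notin S.
Proof.
elim: S => [|y S IH]; first by apply: filterE => s _; rewrite in_nil.
have [->|yt] := eqVneq y t.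
  by apply: filterS IH => s Ss st; rewrite inE negb_or st; exact: Ss.
have ny : \forall s \near t, s != y.
  by apply: open_nbhs_nbhs; split; [exact: open_neq|rewrite /= eq_sym].
by apply: filterS2 IH ny => s Ss sy st; rewrite inE negb_or sy; exact: Ss.
Qed.

Lemma within_at_left t0 t1 t : t0 < t <= t1 ->
  t^'- --> within `[t0, t1] (nbhs t).
Proof.
move=> /andP[t0t tt1] P; rewrite /within/= => tP.
rewrite /at_left; near=> s.
have : s \in `[t0, t1] -> P s by near: s; apply: cvg_within.
apply; rewrite in_itv/=; apply/andP; split.
  by near: s; exact: nbhs_left_ge.
by apply: le_trans tt1; near: s; exact: nbhs_left_le.
Unshelve. all: by end_near. Qed.

Lemma within_at_right t0 t1 t : t0 <= t < t1 ->
  t^'+ --> within `[t0, t1] (nbhs t).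
Proof.
move=> /andP[t0t tt1] P; rewrite /within/= => tP.
rewrite /at_right; near=> s.
have : s \in `[t0, t1] -> P s by near: s; apply: cvg_within.
apply; rewrite in_itv/=; apply/andP; split.
  by apply: le_trans t0t _; near: s; exact: nbhs_right_ge.
by near: s; exact: nbhs_right_le.
Unshelve. all: by end_near. Qed.

End RelativeFilters.

(** * The ramp and its derivative, the pulse *)

Section Ramp.
Context {R : realType}.
Implicit Types (s t ts e : R).

Definition ramp ts e s : R := Num.max (s - ts) 0 - Num.max (s - ts - e) 0.

Definition pulse ts e s : R := if ts < s < ts + e then 1 else 0.

Lemma ramp_increment_bounds ts e s t : 0 < e -> s <= t ->
  0 <= ramp ts e t - ramp ts e s <= t - s.
Proof.
move=> e0 st; rewrite /ramp.
case: (leP (t - ts) 0) => ?; case: (leP (t - ts - e) 0) => ?;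
case: (leP (s - ts) 0) => ?; case: (leP (s - ts - e) 0) => ?;
by apply/andP; split; lra.
Qed.

Lemma ramp_lipschitz ts e s t : 0 < e -> `|ramp ts e t - ramp ts e s| <= `|t - s|.
Proof.
move=> e0; have [st|/ltW ts'] := leP s t.
  by have /andP[h1 h2] := ramp_increment_bounds ts e0 st; rewrite !ger0_norm// subr_ge0.
rewrite distrC [leRHS]distrC.
by have /andP[h1 h2] := ramp_increment_bounds ts e0 ts'; rewrite !ger0_norm// subr_ge0.
Qed.

(** The equality is exact near [t], so difference quotients of the ramp are eventually constant and
    need no limit argument. *)
Lemma ramp_locally_affine ts e t : 0 < e -> t != ts -> t != ts + e ->
  \forall s \near t, ramp ts e s - ramp ts e t = pulse ts e t * (s - t).
Proof.
move=> e0 tts ttse; rewrite /ramp /pulse; have [t1|t1] := ltP t ts.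
  apply: filterS (lt_nbhsl t1) => s s1.
  by rewrite ltNge (ltW t1)/= !max_r; lra.
have {}t1 : ts < t by rewrite lt_neqAle eq_sym tts.
have [t2|t2] := ltP t (ts + e).
  apply: filterS2 (lt_nbhsl t2) (lt_nbhsr t1) => s s1 s2.
  by rewrite t1/= !(max_l (_ : 0 <= _ - ts)) ?(max_r (_ : _ - ts - e <= 0)); lra.
have {}t2 : ts + e < t by rewrite lt_neqAle eq_sym ttse.
apply: filterS (lt_nbhsr t2) => s s1.
by rewrite andbF !max_l; lra.
Qed.

Lemma pulse_left ts e t : 0 < e -> exists k, \forall s \near t^'-, pulse ts e s = k.
Proof.
move=> e0; have [t1|t1] := leP t ts.
  exists 0; near=> s; rewrite /pulse ltNge.
  suff -> : s <= ts by [].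
  by apply: le_trans t1; near: s; exact: nbhs_left_le.
have [t2|t2] := leP t (ts + e).
  exists 1; near=> s; rewrite /pulse.
  suff -> : ts < s < ts + e by [].
  apply/andP; split; first by near: s; exact: nbhs_left_gt.
  by apply: lt_le_trans t2; near: s; exact: nbhs_left_lt.
exists 0; near=> s; rewrite /pulse [X in _ && X]ltNge.
suff -> : ts + e <= s by rewrite andbF.
by near: s; exact: nbhs_left_ge.
Unshelve. all: by end_near. Qed.

Lemma pulse_right ts e t : 0 < e -> exists k, \forall s \near t^'+, pulse ts e s = k.
Proof.
move=> e0; have [t1|t1] := ltP t ts.
  exists 0; near=> s; rewrite /pulse ltNge.
  suff -> : s <= ts by [].
  by near: s; exact: nbhs_right_le.
have [t2|t2] := ltP t (ts + e).
  exists 1; near=> s; rewrite /pulse.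
  suff -> : ts < s < ts + e by [].
  apply/andP; split; last by near: s; exact: nbhs_right_lt.
  by apply: le_lt_trans t1 _; near: s; exact: nbhs_right_gt.
exists 0; near=> s; rewrite /pulse [X in _ && X]ltNge.
suff -> : ts + e <= s by rewrite andbF.
by apply: le_trans t2 _; near: s; exact: nbhs_right_ge.
Unshelve. all: by end_near. Qed.

Lemma pulse_near ts e t : 0 < e -> t != ts -> t != ts + e ->
  \forall s \near t, pulse ts e s = pulse ts e t.
Proof.
move=> e0 tts ttse; rewrite /pulse; have [t1|t1] := ltP t ts.
  apply: filterS (lt_nbhsl t1) => s s1.
  by rewrite [ts < t]ltNge (ltW t1)/= [ts < s]ltNge (ltW s1).
have {}t1 : ts < t by rewrite lt_neqAle eq_sym tts.
have [t2|t2] := ltP t (ts + e).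
  by apply: filterS2 (lt_nbhsl t2) (lt_nbhsr t1) => s s1 s2; rewrite t1 s1 s2.
have {}t2 : ts + e < t by rewrite lt_neqAle eq_sym ttse.
apply: filterS (lt_nbhsr t2) => s s1.
by rewrite [s < _]ltNge (ltW s1)/= !andbF.
Qed.

End Ramp.

(** * Caputo integrals and derivatives of a perturbed trajectory *)

Section CaputoLinearity.
Context {R : realType} {n : nat}.
Local Notation mu := (@lebesgue_measure R).
Local Notation V := 'cV[R]_n.
Implicit Types (phi psi : R -> V) (a c d e t ts : R).

Lemma continuous_itv_bounded (f : R -> R) t0 t1 :
  {within `[t0, t1], continuous f} ->
  exists M : R, forall s, t0 <= s <= t1 -> `|f s| <= M.
Proof.
move=> cf; have /compact_bounded[M [Mr MP]] :=
  continuous_compact cf (@segment_compact _ t0 t1).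
exists (M + 1) => s st; apply: MP; first by rewrite ltrDl.
by exists s => //=; rewrite in_itv.
Qed.

Lemma within_coord_continuous phi (A : set R) (i : 'I_n) :
  {within A, continuous phi} -> {within A, continuous (fun s => phi s i ord0)}.
Proof.
move=> /subspace_continuousP cphi; apply/subspace_continuousP => s As.
apply: (@cvg_comp _ _ _ phi (fun M : V => M i ord0) _ (nbhs (phi s))).
  exact: cphi.
exact: coord_continuous.
Qed.

Lemma integrable_kernel phi a t0 t (i : 'I_n) : 0 < a < 1 ->
  {within `[t0, t], continuous phi} ->
  mu.-integrable `[t0, t]
    (EFin \o (fun s => (t - s) `^ (1 - a - 1) * (phi s - phi t0) i ord0)).
Proof.
move=> a01 cphi.
have cf : {within `[t0, t], continuous (fun s => (phi s - phi t0) i ord0)}.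
  apply: within_coord_continuous => s; apply: cvgB; first exact: cphi.
  exact: cvg_cst.
have [M MP] := continuous_itv_bounded cf.
apply: (@integrable_mul_bounded _ _ _ _ M) => //.
- by apply: integrable_subr_powR; lra.
- by apply: subspace_continuous_measurable_fun.
Qed.

Lemma caputo_intD phi psi a t0 t1 t : 0 < a <= 1 -> t0 <= t <= t1 ->
  {within `[t0, t1], continuous phi} -> {within `[t0, t1], continuous psi} ->
  caputo_int t0 a (fun s => phi s + psi s) t =
  caputo_int t0 a phi t + caputo_int t0 a psi t.
Proof.
move=> /andP[a0 a1] /andP[t0t tt1] cphi cpsi; rewrite /caputo_int /frac_int.
case: ifPn => [_|a1']; first by rewrite opprD addrACA.
have {}a1 : a < 1 by rewrite lt_neqAle a1 andbT -subr_eq0 -oppr_eq0 opprB.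
have sub : `[t0, t] `<=` `[t0, t1].
  by move=> s /=; rewrite !in_itv/= => /andP[-> /le_trans->].
apply/matrixP => i j; rewrite !mxE -mulrDr -RintegralD//.
- congr (_ * _); apply: eq_Rintegral => s _; rewrite -mulrDr; congr (_ * _).
  by rewrite !mxE; ring.
- by apply: integrable_kernel; [lra|exact: continuous_subspaceW cphi].
- by apply: integrable_kernel; [lra|exact: continuous_subspaceW cpsi].
Qed.

(** Up to a constant factor, the Riemann-Liouville integral of order [a] of the indicator of the
    interval from [ts] to [ts + e]. *)
Definition bump a (ts e t : R) : R := ppow a (t - ts) - ppow a (t - ts - e).

(* This is Gamma(a + 1), but only its positivity matters.  The case a = 1 is
   separate because [frac_int] is the identity at order 0. *)
Definition caputo_cst a : R :=
  if a == 1 then 1 else beta_cst a / Gamma (1 - a).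

Lemma caputo_cst_gt0 a : 0 < a <= 1 -> 0 < caputo_cst a.
Proof.
move=> /andP[a0 a1]; rewrite /caputo_cst; case: ifPn => // a1'.
have {}a1 : a < 1 by rewrite lt_neqAle a1'.
rewrite divr_gt0 ?beta_cst_gt0 ?Gamma_gt0//; first by rewrite a0.
by apply/andP; split; lra.
Qed.

Lemma bump_continuous a ts e : 0 < a <= 1 -> continuous (bump a ts e).
Proof.
move=> a01 s; rewrite /bump; apply: cvgB.
- apply: (@continuous_comp _ _ _ (fun s : R => s - ts) (ppow a)).
    by apply: cvgB => //; exact: cvg_cst.
  exact: ppow_continuous.
- apply: (@continuous_comp _ _ _ (fun s : R => s - ts - e) (ppow a)).
    apply: cvgB => //; last exact: cvg_cst.
    by apply: cvgB => //; exact: cvg_cst.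
  exact: ppow_continuous.
Qed.

Lemma bump_before a ts e t : 0 < a -> 0 <= e -> t <= ts -> bump a ts e t = 0.
Proof. by move=> a0 e0 tts; rewrite /bump !ppow_le0E ?subrr//; lra. Qed.

Lemma frac_int_bump a t0 ts e t : 0 < a < 1 -> t0 <= ts -> 0 <= e ->
  \int[mu]_(s in `[t0, t]) ((t - s) `^ (1 - a - 1) * bump a ts e s) =
  beta_cst a * ramp ts e t.
Proof.
move=> a01 t0ts e0.
have ip c : t0 <= c -> mu.-integrable `[t0, t]
    (EFin \o (fun s => (t - s) `^ (1 - a - 1) * ppow a (s - c))).
  move=> t0c; apply: (@integrable_mul_bounded _ _ _ _ (ppow a (t - c))) => //.
  - by apply: integrable_subr_powR; lra.
  - by apply: measurable_ppow; lra.
  - move=> s /=; rewrite in_itv/= => /andP[_ st].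
    by rewrite ger0_norm ?ppow_ge0// ppow_homo//; lra.
under eq_Rintegral do rewrite /bump -[_ - ts - e]addrA -opprD mulrBr.
have te : t0 <= ts + e by lra.
rewrite RintegralB//; [|exact: ip|exact: ip].
rewrite !frac_int_ppow// -mulrBr /ramp; congr (_ * (_ - Num.max _ _)).
by rewrite opprD addrA.
Qed.

Lemma caputo_int_bump a t0 ts e c d (r : V) t : 0 < a <= 1 -> t0 <= ts ->
  0 <= e ->
  caputo_int t0 a (fun s => (c * (bump a ts e s - d)) *: r) t =
  (c * caputo_cst a * ramp ts e t) *: r.
Proof.
move=> /andP[a0 a1] t0ts e0; rewrite /caputo_int /frac_int.
(* The Caputo integral subtracts the value at [t0], where [bump] vanishes since t0 <= ts. Hence the
   constant [d] drops out. *)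
have E s : (c * (bump a ts e s - d)) *: r - (c * (bump a ts e t0 - d)) *: r =
    (c * bump a ts e s) *: r.
  by rewrite (@bump_before _ _ _ t0)// -scalerBl; congr (_ *: _); ring.
rewrite E subr_eq0 /caputo_cst eq_sym.
case: ifPn => [/eqP a1'|a1'].
  (* At a = 1 the truncated powers are the positive parts themselves, so [bump] is already the
     ramp. *)
  congr (_ *: _); rewrite mulr1 /bump /ramp /ppow a1'.
  by rewrite !powRr1// le_max lexx orbT.
have {}a1 : a < 1 by rewrite lt_neqAle a1'.
apply/matrixP => i j; rewrite !mxE.
have -> : \int[mu]_(s in `[t0, t]) ((t - s) `^ (1 - a - 1) *
    ((c * (bump a ts e s - d)) *: r - (c * (bump a ts e t0 - d)) *: r) i ord0) =
  \int[mu]_(s in `[t0, t]) ((c * r i ord0) *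
    ((t - s) `^ (1 - a - 1) * bump a ts e s)).
  by apply: eq_Rintegral => s _; rewrite E !mxE; ring.
rewrite RintegralZl//; last first.
  apply: (@integrable_mul_bounded _ _ _ _ (ppow a (t - ts) + ppow a (t - ts - e))) => //.
  - by apply: integrable_subr_powR; lra.
  - apply: measurable_funTS; apply: continuous_measurable_fun.
    by apply: bump_continuous; lra.
  - move=> s /=; rewrite in_itv/= => /andP[_ st]; rewrite /bump.
    rewrite (le_trans (ler_normB _ _))// !ger0_norm ?ppow_ge0//.
    by rewrite lerD// ppow_homo//; lra.
rewrite frac_int_bump//; last by rewrite a0.
by rewrite (ord1 j); ring.
Qed.

Lemma caputo_shift a t0 t1 phi psi (q : R -> R) (k : R) (r : V) t :
  t0 < t1 -> t0 <= t <= t1 ->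
  (forall s, t0 <= s <= t1 ->
    caputo_int t0 a psi s = caputo_int t0 a phi s + q s *: r) ->
  (\forall s \near t, q s - q t = k * (s - t)) ->
  caputo_defined t0 t1 a phi t ->
  caputo_defined t0 t1 a psi t /\
  caputo t0 t1 a psi t = caputo t0 t1 a phi t + k *: r.
Proof.
move=> t01 tin psiE qk df.
have PF := within_dnbhs_proper t01 tin.
have cv : caputo_quot t0 a psi t s @[s --> within `[t0, t1] t^'] -->
    caputo t0 t1 a phi t + k *: r.
  apply: (@cvg_trans _ ((caputo_quot t0 a phi t s + k *: r)
    @[s --> within `[t0, t1] t^'])); last first.
    by apply: cvgD; [exact: df|exact: cvg_cst].
  apply: near_eq_cvg; rewrite near_withinE /dnbhs near_withinE.
  apply: filterS qk => s qs st; rewrite /= in_itv/= => sin.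
  rewrite /caputo_quot !psiE// opprD addrACA -scalerBl qs [in RHS]scalerDr scalerA.
  by rewrite mulrCA mulVf ?mulr1// subr_eq0.
split; first by apply/cvg_ex; eexists; exact: cv.
by rewrite /caputo; exact: cvg_lim cv.
Qed.

Lemma caputo_lipschitz a t0 t1 psi (C : R) t :
  t0 < t1 -> t0 <= t <= t1 ->
  (forall s, t0 <= s <= t1 ->
    `|caputo_int t0 a psi s - caputo_int t0 a psi t| <= C * `|s - t|) ->
  caputo_defined t0 t1 a psi t -> `|caputo t0 t1 a psi t| <= C.
Proof.
move=> t01 tin lip df; have PF := within_dnbhs_proper t01 tin.
have cv : caputo_quot t0 a psi t s @[s --> within `[t0, t1] t^'] -->
  caputo t0 t1 a psi t by exact: df.
have /= cn := cvg_norm cv.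
apply: (cvgr_to_le (cn _)); rewrite near_withinE /dnbhs near_withinE.
apply: nearW => s st; rewrite /= in_itv/= => sin.
rewrite /caputo_quot normrZ normfV mulrC ler_pdivrMr; first exact: lip.
by rewrite normr_gt0 subr_eq0.
Qed.

Lemma abs_continuous_ramp t0 t1 phi psi (q : R -> R) (C : R) (r : V) :
  0 <= C ->
  (forall s, t0 <= s <= t1 -> psi s = phi s + q s *: r) ->
  (forall s t, s <= t -> `|q t - q s| <= C * (t - s)) ->
  abs_continuous t0 t1 phi -> abs_continuous t0 t1 psi.
Proof.
move=> C0 psiE qC acphi e e0.
have N0 : 0 < n%:R + 1 :> R by rewrite ltr_wpDl.
(* The factor n comes from [enorm_add_le] and the 2 from its two summands; the added 1 covers n = 0
   and makes the last inequality strict. *)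
pose e' := e / (2 * (n%:R + 1)).
have e'0 : 0 < e' by rewrite divr_gt0// mulr_gt0.
have [d d0 dP] := acphi e' e'0.
pose K := C * enorm r + 1.
have K0 : 0 < K by rewrite ltr_wpDl// mulr_ge0// enorm_ge0.
exists (Num.min d (e' / K)); first by rewrite lt_min d0 divr_gt0.
move=> m u v uv triv; rewrite lt_min => /andP[sd se].
have {}dP := dP _ _ _ uv triv sd.
apply: (@le_lt_trans _ _ (\sum_(i < m) (n%:R * (enorm (phi (v i) - phi (u i)) +
    K * (v i - u i))))).
  apply: ler_sum => i _; have [u0 [ui v1]] := uv i.
  rewrite !psiE; [|by apply/andP; split; lra..].
  rewrite opprD addrACA -scalerBl (le_trans (enorm_add_le _ _))//.
  rewrite ler_wpM2l// lerD2l enormZ.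
  rewrite (@le_trans _ _ (C * (v i - u i) * enorm r))//.
    by rewrite ler_wpM2r ?enorm_ge0// qC.
  rewrite mulrAC ler_wpM2r ?subr_ge0//; rewrite /K; lra.
rewrite -mulr_sumr big_split/= -mulr_sumr.
have : K * \sum_(i < m) (v i - u i) < e' by rewrite mulrC -ltr_pdivlMr.
move=> H; apply: (@le_lt_trans _ _ (n%:R * (e' + e'))).
  by rewrite ler_wpM2l// lerD// ltW.
rewrite (@lt_le_trans _ _ ((n%:R + 1) * (e' + e')))//.
  by rewrite ltr_pM2r ?ltrDl// addr_gt0.
rewrite /e' le_eqVlt; apply/orP; left; apply/eqP; field.
by rewrite gt_eqF.
Qed.

End CaputoLinearity.

(** * The varied trajectory: regularity and weak distance *)

Section Variation.
Context {R : realType} {n : nat}.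
Local Notation V := 'cV[R]_n.
Implicit Types (x : R -> V) (a c d e t ts : R) (r : V).

(* Taking d := bump a ts e t1 keeps the endpoint condition at t1. *)
Definition variation x a ts e c d r : R -> V :=
  fun s => x s + (c * (bump a ts e s - d)) *: r.

Lemma variationB x a ts e c d r :
  (fun s => variation x a ts e c d r s - x s) =
  (fun s => (c * (bump a ts e s - d)) *: r).
Proof. by apply/funext => s; rewrite /variation addrAC subrr add0r. Qed.

Lemma variation_continuous x a ts e c d r (A : set R) : 0 < a <= 1 ->
  {within A, continuous x} -> {within A, continuous (variation x a ts e c d r)}.
Proof.
move=> a01 /subspace_continuousP cx; apply/subspace_continuousP => s As.
apply: cvgD; first exact: cx.
apply: cvgZr_tmp; apply: cvg_within_filter.
apply: cvgM; first exact: cvg_cst.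
by apply: cvgB; [exact: bump_continuous|exact: cvg_cst].
Qed.

Lemma caputo_int_variation x a t0 t1 ts e c d r t :
  0 < a <= 1 -> t0 <= ts -> 0 <= e -> t0 <= t <= t1 ->
  {within `[t0, t1], continuous x} ->
  caputo_int t0 a (variation x a ts e c d r) t =
  caputo_int t0 a x t + (c * caputo_cst a * ramp ts e t) *: r.
Proof.
move=> a01 t0ts e0 tin cx; rewrite /variation (@caputo_intD _ _ _ _ _ _ t1)//.
  by rewrite caputo_int_bump.
have c0 : {within `[t0, t1], continuous (fun=> 0 : V)}.
  by move=> s; exact: cvg_cst.
have -> : (fun s => (c * (bump a ts e s - d)) *: r) =
    variation (fun=> 0) a ts e c d r.
  by apply/funext => s; rewrite /variation add0r.
exact: variation_continuous.
Qed.

Lemma caputo_variation x a t0 t1 ts e c d r t :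
  t0 < t1 -> 0 < a <= 1 -> t0 <= ts -> 0 < e -> t0 <= t <= t1 ->
  {within `[t0, t1], continuous x} -> t != ts -> t != ts + e ->
  caputo_defined t0 t1 a x t ->
  caputo_defined t0 t1 a (variation x a ts e c d r) t /\
  caputo t0 t1 a (variation x a ts e c d r) t =
  caputo t0 t1 a x t + (c * caputo_cst a * pulse ts e t) *: r.
Proof.
move=> t01 a01 t0ts e0 tin cx tts ttse df.
apply: (@caputo_shift _ _ _ _ _ _ _ (fun s => c * caputo_cst a * ramp ts e s)) => //.
  by move=> s sin; apply: (@caputo_int_variation _ _ _ t1) => //; exact: ltW.
apply: filterS (ramp_locally_affine e0 tts ttse) => s sE.
by rewrite -mulrBr sE mulrA.
Qed.

Lemma PCalpha_variation x a t0 t1 ts e c d r :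
  0 < a <= 1 -> t0 < ts -> 0 < e -> ts + e < t1 ->
  PCalpha t0 t1 a x -> PCalpha t0 t1 a (variation x a ts e c d r).
Proof.
move=> a01 t0ts e0 tse [cx ac [S [Sin Scont Slim]]].
have t01 : t0 < t1 by lra.
set y := variation _ _ _ _ _ _ _.
pose k s := c * caputo_cst a * pulse ts e s.
(* The exceptional points are finitely many, so a punctured neighborhood of any [t], exceptional or
   not, avoids them. *)
have nearE t : \forall s \near t, s != t -> t0 <= s <= t1 ->
    caputo t0 t1 a y s = caputo t0 t1 a x s + k s *: r.
  apply: filterS (near_notin [:: ts, ts + e & S] t) => s + st sin.
  move=> /(_ st); rewrite !inE !negb_or => /and3P[s1 s2 s3].
  have [df _] := Scont _ sin s3.
  by have [] := caputo_variation c d r t01 a01 (ltW t0ts) e0 sin cx s1 s2 df.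
split.
- exact: variation_continuous.
- apply: (@abs_continuous_ramp _ _ _ _ (caputo_int t0 a x) _
    (fun s => c * caputo_cst a * ramp ts e s) `|c * caputo_cst a| r) => //.
  + by move=> s sin; apply: (@caputo_int_variation _ _ _ t1) => //; exact: ltW.
  + move=> s t st; rewrite -mulrBr normrM ler_wpM2l//.
    by have := ramp_lipschitz ts s t e0; rewrite [leRHS]ger0_norm// subr_ge0.
exists [:: ts, ts + e & S]; split.
- move=> t; rewrite !inE => /or3P[/eqP->|/eqP->|/Sin//]; apply/andP; split; lra.
- move=> t tin; rewrite !inE !negb_or => /and3P[tts ttse tS].
  have [df cv] := Scont _ tin tS.
  have [dy yE] := caputo_variation c d r t01 a01 (ltW t0ts) e0 tin cx tts ttse df.
  split; first exact: dy.
  rewrite yE.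
  apply: (@cvg_trans _ ((caputo t0 t1 a x s + k t *: r)
    @[s --> within `[t0, t1] (nbhs t)])); last first.
    by apply: cvgD; [exact: cv|exact: cvg_cst].
  apply: near_eq_cvg; rewrite near_withinE.
  apply: filterS2 (nearE t) (pulse_near e0 tts ttse) => s sE kE.
  rewrite /= in_itv/= => sin; have [->|st] := eqVneq s t; first by rewrite yE.
  rewrite (sE st sin) /k kE; reflexivity.
(* The new corners [ts] and [ts + e] need not lie in [S]; there the one-sided limits of the old
   derivative come from its continuity. *)
- have xlim t : t0 < t < t1 -> cvg (caputo t0 t1 a x s @[s --> t^'-]) /\
      cvg (caputo t0 t1 a x s @[s --> t^'+]).
    move=> /andP[t0t tt1]; have [tS|tS] := boolP (t \in S); first exact: Slim.
    have [|_ cv] := Scont _ _ tS; first by rewrite !ltW.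
    split; apply/cvg_ex; exists (caputo t0 t1 a x t).
    + apply: cvg_trans cv; apply: cvg_app; apply: within_at_left.
      by rewrite t0t ltW.
    + apply: cvg_trans cv; apply: cvg_app; apply: within_at_right.
      by rewrite tt1 ltW.
  move=> t tS'.
  have tin : t0 < t < t1.
    by move: tS'; rewrite !inE => /or3P[/eqP->|/eqP->|/Sin//]; apply/andP; split; lra.
  have /andP[t0t tt1] := tin; have [cl cr] := xlim _ tin; split.
  + have [k0 kE] := pulse_left ts t e0.
    apply/cvg_ex; exists (lim (caputo t0 t1 a x s @[s --> t^'-]) +
      (c * caputo_cst a * k0) *: r).
    apply: (@cvg_trans _ ((caputo t0 t1 a x s + (c * caputo_cst a * k0) *: r)
      @[s --> t^'-])); last by apply: cvgD; [exact: cl|exact: cvg_cst].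
    apply: near_eq_cvg; near=> s; have kEs : pulse ts e s = k0 by near: s; exact: kE.
    have st : s != t by near: s; exact: nbhs_left_neq.
    have -> : caputo t0 t1 a y s = caputo t0 t1 a x s + k s *: r.
      have sE : s != t -> t0 <= s <= t1 ->
        caputo t0 t1 a y s = caputo t0 t1 a x s + k s *: r.
        by near: s; apply: cvg_within; exact: nearE.
      apply: (sE st); apply/andP; split.
        by near: s; exact: nbhs_left_ge.
      by apply: le_trans (ltW tt1); near: s; exact: nbhs_left_le.
    rewrite /k kEs; reflexivity.
  + have [k0 kE] := pulse_right ts t e0.
    apply/cvg_ex; exists (lim (caputo t0 t1 a x s @[s --> t^'+]) +
      (c * caputo_cst a * k0) *: r).
    apply: (@cvg_trans _ ((caputo t0 t1 a x s + (c * caputo_cst a * k0) *: r)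
      @[s --> t^'+])); last by apply: cvgD; [exact: cr|exact: cvg_cst].
    apply: near_eq_cvg; near=> s; have kEs : pulse ts e s = k0 by near: s; exact: kE.
    have st : s != t by near: s; exact: nbhs_right_neq.
    have -> : caputo t0 t1 a y s = caputo t0 t1 a x s + k s *: r.
      have sE : s != t -> t0 <= s <= t1 ->
        caputo t0 t1 a y s = caputo t0 t1 a x s + k s *: r.
        by near: s; apply: cvg_within; exact: nearE.
      apply: (sE st); apply/andP; split.
        by apply: le_trans (ltW t0t) _; near: s; exact: nbhs_right_ge.
      by near: s; exact: nbhs_right_le.
    rewrite /k kEs; reflexivity.
Unshelve. all: by end_near. Qed.

Lemma weak_dist_variation x a t0 t1 ts e c d r (B : R) :
  t0 < t1 -> 0 < a <= 1 -> t0 <= ts -> 0 < e ->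
  (forall s, t0 <= s <= t1 -> `|bump a ts e s - d| <= B) ->
  (weak_dist t0 t1 a (variation x a ts e c d r) x <=
   (`|c| * (B * enorm r + n%:R * (caputo_cst a * `|r|)))%:E)%E.
Proof.
move=> t01 a01 t0ts e0 bB; rewrite /weak_dist variationB mulrDr EFinD.
have K0 := caputo_cst_gt0 a01.
apply: leeD; apply: ge_ereal_sup => _ [s /= sin <-]; rewrite lee_fin.
  rewrite -[_ + _]/(variation x a ts e c d r s - x s).
  have -> : variation x a ts e c d r s - x s = (c * (bump a ts e s - d)) *: r.
    by rewrite /variation addrAC subrr add0r.
  rewrite enormZ normrM -mulrA ler_wpM2l// ler_wpM2r ?enorm_ge0// bB//.
move: sin; rewrite in_itv/= => -[sin df].
(* The factor n is the cost of passing to the matrix norm, in which [caputo_lipschitz] is stated. *)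
apply: le_trans (enorm_le_norm _) _; rewrite mulrCA ler_wpM2l//.
apply: (caputo_lipschitz t01 sin) df => u uin.
rewrite !caputo_int_bump//; [|exact: ltW..].
rewrite -scalerBl -mulrBr normrZ !normrM (ger0_norm (ltW K0)).
rewrite -!mulrA ler_wpM2l// ler_wpM2l ?(ltW K0)// mulrC ler_wpM2l//.
exact: ramp_lipschitz.
Qed.

(* Directional derivatives from partial derivatives, and second differences *)
End Variation.

Section DirectionalCalculus.
Context {R : realType} {n : nat}.
Local Notation V := 'cV[R]_n.
Implicit Types (f : V -> R) (F : V -> V) (u v x y z r : V).

Lemma norm_le_coord u (M : R) : 0 <= M ->
  (forall i, `|u i ord0| <= M) -> `|u| <= M.
Proof.
move=> M0 uM; rewrite [leLHS]/Num.norm/= mx_normrE; apply: bigmax_le => // -[i j] _ /=.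
by rewrite (ord1 j).
Qed.

Lemma MVT01 (g dg : R -> R) :
  (forall h : R, 0 <= h <= 1 -> is_derive h 1 g (dg h)) ->
  exists2 c, 0 <= c <= 1 & g 1 - g 0 = dg c.
Proof.
move=> dgE; have [||c] := @MVT_segment R g dg 0 1 ler01.
- by move=> h; rewrite in_itv/= => /andP[/ltW ? /ltW ?]; apply: dgE; apply/andP.
- apply: derivable_within_continuous => h; rewrite in_itv/= => hin.
  by have [] := dgE _ hin.
- by rewrite in_itv/= subr0 mulr1 => cin E; exists c.
Qed.

Lemma line_is_derive1 f x v (s D : R) : is_derive (x + s *: v) v f D ->
  is_derive s 1 (fun h : R => f (x + h *: v)) D.
Proof.
move=> [df dE].
have E : (fun h : R => h^-1 *: (((fun h => f (x + h *: v)) \o shift s) (h *: 1) -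
      f (x + s *: v))) =
    (fun h : R => h^-1 *: ((f \o shift (x + s *: v)) (h *: v) - f (x + s *: v))).
  apply/funext => h /=; congr (_ *: (f _ - _)).
  by rewrite [h *: 1]mulr1 scalerDl addrCA.
split; first by rewrite /derivable E; exact: df.
by rewrite /derive E; exact: dE.
Qed.

Lemma is_derive_comp_mulr (g : R -> R) (c h D : R) :
  is_derive (h * c) 1 g D -> is_derive h 1 (fun u : R => g (u * c)) (D * c).
Proof.
move=> dg.
have dl : is_derive h 1 (fun u : R => u * c) c.
  apply: is_derive_eq (is_deriveM (is_derive_id h 1) (is_derive_cst c h 1)) _.
  by rewrite scaler0 add0r /GRing.scale/= mulr1.
have H := @is_derive1_comp _ g (fun u : R => u * c) h D c dg dl.
exact: H.
Qed.

Lemma is_derive_sqr (k h : R) :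
  is_derive h 1 (fun u : R => k * (u * u)) (k * (2 * h)).
Proof.
have H := is_deriveZ k
  (is_deriveM (is_derive_id h (1 : R)) (is_derive_id h 1)).
apply: (is_derive_eq H).
by rewrite /GRing.scale/=; ring.
Qed.

Lemma line_is_derive f x v (c h D : R) : is_derive (x + (h * c) *: v) v f D ->
  is_derive h 1 (fun u : R => f (x + (u * c) *: v)) (D * c).
Proof.
move=> /line_is_derive1 df.
exact: (@is_derive_comp_mulr (fun s : R => f (x + s *: v))).
Qed.

Lemma line_MVT f x v (c : R) (D : V -> R) :
  (forall t : R, 0 <= t <= 1 ->
    is_derive (x + (t * c) *: v) v f (D (x + (t * c) *: v))) ->
  exists2 t : R, 0 <= t <= 1 &
    f (x + c *: v) - f x = D (x + (t * c) *: v) * c.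
Proof.
move=> df; have [t t01|t t01 E] := @MVT01
    (fun t => f (x + (t * c) *: v)) (fun t => D (x + (t * c) *: v) * c).
  by apply: line_is_derive; exact: df.
by exists t => //; rewrite -E mul1r mul0r scale0r addr0.
Qed.

(* The path from x to x + v that changes one coordinate at a time. *)
Definition trunc_col v (k : nat) : V :=
  \col_i (if (i < k)%N then v i ord0 else 0).

Lemma partial_MVT f x v (rho : R) :
  (forall y, `|y - x| < rho -> partially_derivable f y) -> `|v| < rho ->
  exists xi : 'I_n -> V, (forall i, `|xi i - x| <= `|v|) /\
    f (x + v) - f x = \sum_i v i ord0 * 'D_(delta_mx i ord0) f (xi i).
Proof.
move=> df vrho.
have step (k : 'I_n) : exists z : V, `|z - x| <= `|v| /\
    f (x + trunc_col v k.+1) - f (x + trunc_col v k) =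
    v k ord0 * 'D_(delta_mx k ord0) f z.
  (* In the maximum norm the intermediate points cannot leave the ball of radius [|v|]: each
     coordinate of the displacement is 0, a fraction of that of [v], or that of [v]. *)
  have bnd (h : R) : 0 <= h <= 1 ->
      `|x + trunc_col v k + (h * v k ord0) *: delta_mx k ord0 - x| <= `|v|.
    move=> /andP[h0 h1]; rewrite -[x + _ + _]addrA [x + _]addrC addrK.
    apply: norm_le_coord => // i; rewrite !mxE eqxx andbT.
    have [->|ik] := eqVneq i k.
      rewrite ltnn add0r mulr1 normrM ger0_norm//.
      by rewrite (le_trans _ (coord_le_norm v k ord0))// ler_piMl.
    rewrite mulr0 addr0; case: ifP => _; last by rewrite normr0.
    exact: coord_le_norm.
  have [|c c01 E] := @MVT01
    (fun h => f (x + trunc_col v k + (h * v k ord0) *: delta_mx k ord0))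
    (fun h => 'D_(delta_mx k ord0) f
       (x + trunc_col v k + (h * v k ord0) *: delta_mx k ord0) * v k ord0).
    move=> h h01; apply: line_is_derive; apply: derivableP; apply: df.
    exact: le_lt_trans (bnd _ h01) vrho.
  exists (x + trunc_col v k + (c * v k ord0) *: delta_mx k ord0); split.
    exact: bnd.
  rewrite mulrC -E mul1r mul0r scale0r addr0; congr (f _ - _).
  rewrite -addrA; congr (_ + _); apply/matrixP => i j.
  rewrite !mxE (ord1 j) eqxx andbT ltnS leq_eqVlt.
  have [->|ik] := eqVneq i k; first by rewrite eqxx ltnn add0r mulr1.
  by rewrite mulr0 addr0 -val_eqE/= in ik *; rewrite (negbTE ik).
have [xi xiP] := choice step.
exists xi; split; first by move=> i; have [] := xiP i.
rewrite -(eq_bigr _ (fun i _ => (xiP i).2)).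
rewrite -(big_mkord xpredT (fun k => f (x + trunc_col v k.+1) - f (x + trunc_col v k))).
rewrite telescope_sumr//; congr (f (_ + _) - f _).
- by apply/matrixP => i j; rewrite !mxE (ord1 j) ltn_ord.
- rewrite (_ : trunc_col v 0 = 0) ?addr0//.
  by apply/matrixP => i j; rewrite !mxE.
Qed.

(** The hypotheses differentiate along coordinate axes only, while the variation moves along [r].
    Continuity of the gradient bridges the two: the increment is a sum of partial derivatives at
    points that all tend to [x]. *)
Lemma is_derive_C1 f x v (rho : R) : 0 < rho ->
  (forall y, `|y - x| < rho -> partially_derivable f y) ->
  {for x, continuous (grad f)} ->
  is_derive x v f (dotp (grad f x) v).
Proof.
move=> rho0 df cg.
have cv : (fun h : R => h^-1 *: ((f \o shift x) (h *: v) - f x)) @ 0^' -->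
    dotp (grad f x) v.
  apply/cvgrPdist_le => e e0.
  pose N := \sum_i `|v i ord0| + 1.
  have N0 : 0 < N by rewrite ltr_wpDl// sumr_ge0.
  have eN : 0 < e / N by rewrite divr_gt0.
  have /cvgrPdist_lt/(_ _ eN) /nbhs_ballP[d /= d0 dP] := cg.
  have mdr : 0 < Num.min d rho by rewrite lt_min d0.
  have v0 : 0 < `|v| + 1 by rewrite ltr_wpDl.
  rewrite /dnbhs near_withinE; apply/nbhs_ballP.
  exists (Num.min d rho / (`|v| + 1)); first by rewrite /= divr_gt0.
  move=> h; rewrite -ball_normE/= sub0r normrN ltr_pdivlMr// => hd h0.
  have hv : `|h *: v| < Num.min d rho.
    by rewrite normrZ (le_lt_trans _ hd)// ler_wpM2l// lerDl.
  have /andP[hvd hvr] : (`|h *: v| < d) && (`|h *: v| < rho) by rewrite -lt_min.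
  have [xi [xin E]] := partial_MVT df hvr.
  rewrite /= [h *: v + x]addrC E.
  have -> : h^-1 *: (\sum_i (h *: v) i ord0 * 'D_(delta_mx i ord0) f (xi i)) =
      \sum_i v i ord0 * 'D_(delta_mx i ord0) f (xi i).
    rewrite scaler_sumr; apply: eq_bigr => i _; rewrite mxE.
    by rewrite /GRing.scale/= -mulrA mulKf.
  rewrite /dotp -sumrB (le_trans (ler_norm_sum _ _ _))//.
  apply: (@le_trans _ _ (\sum_i `|v i ord0| * (e / N))).
    apply: ler_sum => i _; rewrite mxE mulrC -mulrBr normrM ler_wpM2l//.
    have := dP (xi i); rewrite -ball_normE/= distrC => /(_ (le_lt_trans (xin i) hvd)).
    move=> /ltW; apply: le_trans.
    by have := coord_le_norm (grad f x - grad f (xi i)) i ord0; rewrite !mxE.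
  rewrite -mulr_suml mulrCA ler_piMr//; first exact: ltW.
  by rewrite ler_pdivrMr// mul1r /N lerDl.
split; first by apply/cvg_ex; eexists; exact: cv.
exact: cvg_lim cv.
Qed.

Lemma dotpBl u v r : dotp (u - v) r = dotp u r - dotp v r.
Proof. by rewrite /dotp -sumrB; apply: eq_bigr => i _; rewrite !mxE mulrBl. Qed.

Lemma dotpZl (c : R) u r : dotp (c *: u) r = c * dotp u r.
Proof. by rewrite /dotp mulr_sumr; apply: eq_bigr => i _; rewrite !mxE mulrA. Qed.

Lemma dotp_trmx (A : 'M[R]_n) u v : dotp (A^T *m u) v = dotp (A *m v) u.
Proof.
rewrite /dotp; under eq_bigr do rewrite mxE mulr_suml.
under [RHS]eq_bigr do rewrite mxE mulr_suml.
rewrite exchange_big/=; apply: eq_bigr => i _; apply: eq_bigr => j _.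
by rewrite !mxE; ring.
Qed.

Lemma bounded_additive_continuous (U W : normedModType R) (phi : U -> W) (C : R) :
  (forall a b, phi (a - b) = phi a - phi b) ->
  (forall a, `|phi a| <= C * `|a|) -> continuous phi.
Proof.
move=> phiB phiC a; apply/cvgrPdist_le => e e0.
have C0 : 0 < `|C| + 1 by rewrite ltr_wpDl.
apply/nbhs_ballP; exists (e / (`|C| + 1)); first by rewrite /= divr_gt0.
move=> b; rewrite -ball_normE/= ltr_pdivlMr// mulrC => /ltW.
rewrite -phiB; apply: le_trans; rewrite (le_trans (phiC _))// ler_wpM2r//.
by rewrite (le_trans (ler_norm _))// lerDl.
Qed.

Lemma dotp_continuous r : continuous (fun u : V => dotp u r).
Proof.
apply: (@bounded_additive_continuous _ _ _ (\sum_i `|r i ord0|)).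
  by move=> u v; exact: dotpBl.
move=> u; rewrite (le_trans (ler_norm_sum _ _ _))// mulr_suml ler_sum// => i _.
by rewrite normrM mulrC ler_wpM2l// coord_le_norm.
Qed.

Lemma trmx_mul_continuous r : continuous (fun A : 'M[R]_n => A^T *m r).
Proof.
apply: (@bounded_additive_continuous _ _ _ (\sum_i `|r i ord0|)).
  by move=> A B; rewrite linearB/= mulmxBl.
move=> A; apply: norm_le_coord; first by rewrite mulr_ge0// sumr_ge0.
move=> i; rewrite mxE (le_trans (ler_norm_sum _ _ _))// mulr_suml ler_sum// => k _.
by rewrite normrM mxE mulrC ler_wpM2l// coord_le_norm.
Qed.

Lemma mx_form_continuous r z : continuous (fun A : 'M[R]_n => dotp (A *m r) z).
Proof.
have -> : (fun A : 'M[R]_n => dotp (A *m r) z) = (fun A => dotp (A^T *m z) r).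
  by apply/funext => A; rewrite dotp_trmx.
move=> A.
apply: (@cvg_comp _ _ _ (fun A : 'M[R]_n => A^T *m z) (fun u => dotp u r) _
  (nbhs (A^T *m z))); first exact: trmx_mul_continuous.
exact: dotp_continuous.
Qed.

Lemma derivable_dotp F x v r : derivable F x v ->
  is_derive x v (fun z => dotp (F z) r) (dotp ('D_v F x) r).
Proof.
move=> dF.
have cv : (fun h : R => h^-1 *: (((fun z => dotp (F z) r) \o shift x) (h *: v) -
    dotp (F x) r)) @ 0^' --> dotp ('D_v F x) r.
  have -> : (fun h : R => h^-1 *: (((fun z => dotp (F z) r) \o shift x) (h *: v) -
    dotp (F x) r)) = (fun h : R => dotp (h^-1 *: ((F \o shift x) (h *: v) - F x)) r).
    by apply/funext => h /=; rewrite dotpZl dotpBl.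
  apply: (@cvg_comp _ _ _ (fun h : R => h^-1 *: ((F \o shift x) (h *: v) - F x))
    (fun u => dotp u r) _ (nbhs ('D_v F x))); first exact: dF.
  exact: dotp_continuous.
split; first by apply/cvg_ex; eexists; exact: cv.
exact: cvg_lim cv.
Qed.

Lemma grad_dotp F x r : partially_derivable F x ->
  grad (fun z => dotp (F z) r) x = (jac F x)^T *m r.
Proof.
move=> dF; apply/matrixP => i j; rewrite !mxE (ord1 j).
have [_ ->] := derivable_dotp r (dF i).
by rewrite /dotp; apply: eq_bigr => k _; rewrite !mxE.
Qed.

(** Pairing with [r] reduces the vector field to a scalar function with gradient J^T r, to which
    [is_derive_C1] applies. *)
Lemma is_derive_field F x v r (rho : R) : 0 < rho ->
  (forall y, `|y - x| < rho -> partially_derivable F y) ->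
  {for x, continuous (jac F)} ->
  is_derive x v (fun z => dotp (F z) r) (dotp (jac F x *m v) r).
Proof.
move=> rho0 dF cj; rewrite -dotp_trmx -grad_dotp; last first.
  by apply: dF; rewrite subrr normr0.
apply: (is_derive_C1 _ rho0).
  by move=> y yx i; have [] := derivable_dotp r (dF y yx i).
rewrite /prop_for /continuous_at grad_dotp; last first.
  by apply: dF; rewrite subrr normr0.
apply: (@cvg_trans _ (((jac F y)^T *m r) @[y --> x])).
  apply: (@near_eq_cvg _ _ (nbhs x)); near=> y; rewrite grad_dotp//; apply: dF.
  have : ball x rho y by near: y; exact: nbhsx_ballx.
  by rewrite -ball_normE/= distrC.
apply: (@cvg_comp _ _ _ (jac F) (fun A : 'M[R]_n => A^T *m r) _ (nbhs (jac F x))).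
  exact: cj.
exact: trmx_mul_continuous.
Unshelve. all: by end_near. Qed.

Lemma ball_shrink x y z (rho : R) : `|y - x| < rho ->
  `|z - y| < rho - `|y - x| -> `|z - x| < rho.
Proof.
move=> yx zy; rewrite -(subrK y z) -addrA (le_lt_trans (ler_normD _ _))//.
by rewrite -ltrBrDr.
Qed.

(** The one-sided bound [c] may have either sign: a negative one expresses the concavity of L in y
    along the pulse, a nonnegative one controls the terminal cost. *)
Lemma second_difference_le f x r (rho c s : R) :
  (forall y, `|y - x| < rho ->
     [/\ partially_derivable f y, {for y, continuous (grad f)},
         partially_derivable (grad f) y, {for y, continuous (jac (grad f))}
       & dotp (jac (grad f) y *m r) r <= c]) ->
  `|s *: r| < rho ->
  f (x + s *: r) + f (x - s *: r) - 2 * f x <= c * s ^+ 2.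
Proof.
move=> H srho.
have d1 y : `|y - x| < rho -> is_derive y r f (dotp (grad f y) r).
  move=> yx; have e0 : 0 < rho - `|y - x| by rewrite subr_gt0.
  have [_ cg _ _ _] := H _ yx.
  apply: (is_derive_C1 _ e0) => // z zy.
  by have [] := H z (ball_shrink yx zy).
have d2 y : `|y - x| < rho ->
    is_derive y r (fun z => dotp (grad f z) r) (dotp (jac (grad f) y *m r) r).
  move=> yx; have e0 : 0 < rho - `|y - x| by rewrite subr_gt0.
  have [_ _ _ cj _] := H _ yx.
  apply: (is_derive_field _ _ e0) => // z zy.
  by have [] := H z (ball_shrink yx zy).
have inb (h : R) : `|h| <= 1 -> `|x + (h * s) *: r - x| < rho.
  move=> h1; rewrite addrAC subrr add0r -scalerA normrZ.
  by rewrite (le_lt_trans _ srho)// ler_piMl.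
(* Subtracting the quadratic makes the derivative of chi nonpositive on [0, 1]. *)
pose chi h := f (x + (h * s) *: r) + f (x + (h * - s) *: r) - c * s ^+ 2 * (h * h).
pose dchi h := dotp (grad f (x + (h * s) *: r)) r * s +
  dotp (grad f (x + (h * - s) *: r)) r * - s - c * s ^+ 2 * (2 * h).
have [|h /andP[h0 h1] E] := @MVT01 chi dchi.
  move=> h /andP[h0 h1]; have h1' : `|h| <= 1 by rewrite ger0_norm.
  apply: is_deriveB; first apply: is_deriveD.
  - by apply: line_is_derive; apply: d1; exact: inb.
  - apply: line_is_derive; apply: d1; rewrite mulrN -mulNr; apply: inb.
    by rewrite normrN.
  - exact: is_derive_sqr.
have [|k /andP[k0 k1] E2] := @MVT01
    (fun k => dotp (grad f (x + (h * - s) *: r + (k * (2 * h * s)) *: r)) r)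
    (fun k => dotp (jac (grad f) (x + (h * - s) *: r + (k * (2 * h * s)) *: r) *m r) r
       * (2 * h * s)).
  move=> k /andP[k0 k1].
  apply: (@line_is_derive (fun z => dotp (grad f z) r)); apply: d2.
  have -> : x + (h * - s) *: r + (k * (2 * h * s)) *: r =
      x + ((h * (2 * k - 1)) * s) *: r.
    by rewrite -addrA -scalerDl; congr (_ + _ *: _); ring.
  apply: inb; rewrite normrM ger0_norm// mulr_ile1// ler_norml; apply/andP; split; lra.
have Hk := @inb (h * (2 * k - 1)).
have {Hk}Hk : dotp (jac (grad f) (x + (h * - s) *: r + (k * (2 * h * s)) *: r) *m r) r <= c.
  have -> : x + (h * - s) *: r + (k * (2 * h * s)) *: r =
      x + ((h * (2 * k - 1)) * s) *: r.
    by rewrite -addrA -scalerDl; congr (_ + _ *: _); ring.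
  have [|//] := H (x + ((h * (2 * k - 1)) * s) *: r).
  apply: Hk; rewrite normrM ger0_norm// mulr_ile1// ler_norml; apply/andP; split; lra.
move: E2; rewrite mul1r mul0r scale0r addr0.
have -> : x + (h * - s) *: r + (2 * h * s) *: r = x + (h * s) *: r.
  by rewrite -addrA -scalerDl; congr (_ + _ *: _); ring.
move=> E2; have : dchi h <= 0.
  have -> : dchi h = 2 * h * s ^+ 2 *
    (dotp (jac (grad f) (x + (h * - s) *: r + (k * (2 * h * s)) *: r) *m r) r - c).
    rewrite mulrBr [X in X - _](_ : _ = s * (dotp (jac (grad f)
      (x + (h * - s) *: r + (k * (2 * h * s)) *: r) *m r) r * (2 * h * s))); last by ring.
    rewrite -E2 /dchi; ring.
  by rewrite mulr_ge0_le0 ?subr_le0// mulr_ge0 ?sqr_ge0// mulr_ge0.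
rewrite -E /chi !mul1r !mul0r !scale0r !addr0 mulr0 mulr1 scaleNr.
lra.
Qed.

(** [G], [A] and [B] stand for L_x, L_xx and L_xy tested on [r]. Differentiating first in x leaves a
    difference of [G] between opposite points, which is O(h) + O(k); the outer factor [h] then gives
    second order. *)
Lemma mixed_difference_abs (L G A B : V -> V -> R) x y r (rho M h k : R) :
  (forall x' y', `|x' - x| < rho -> `|y' - y| < rho ->
     [/\ is_derive x' r (fun u => L u y') (G x' y'),
         is_derive x' r (fun u => G u y') (A x' y'),
         is_derive y' r (G x') (B x' y')
       & `|A x' y'| <= M /\ `|B x' y'| <= M]) ->
  `|h *: r| < rho -> `|k *: r| < rho ->
  L (x + h *: r) (y + k *: r) - L x (y + k *: r) +
  (L (x - h *: r) (y - k *: r) - L x (y - k *: r)) <=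
  2 * M * (h ^+ 2 + `|h| * `|k|).
Proof.
move=> H hrho krho.
have inb (z : V) (s t : R) : `|s *: r| < rho -> `|t| <= 1 ->
    `|z + (t * s) *: r - z| < rho.
  move=> srho t1; rewrite addrAC subrr add0r -scalerA normrZ.
  by rewrite (le_lt_trans _ srho)// ler_piMl.
have inb1 (z : V) (s : R) : `|s *: r| < rho -> `|z + s *: r - z| < rho.
  by move=> srho; have := inb z s 1 srho; rewrite normr1 mul1r; exact.
have hrho' : `|(- h) *: r| < rho by rewrite scaleNr normrN.
have krho' : `|(- k) *: r| < rho by rewrite scaleNr normrN.
have ky := inb1 y _ krho; have ky' := inb1 y _ krho'.
set y1 := y + k *: r in ky *; set y2 := y + (- k) *: r in ky'.
have [t t01|t /andP[t0 t1] E] := @MVT01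
  (fun t => L (x + (t * h) *: r) y1 + L (x + (t * - h) *: r) y2)
  (fun t => G (x + (t * h) *: r) y1 * h + G (x + (t * - h) *: r) y2 * - h).
  have /andP[t0 t1] := t01; have t1' : `|t| <= 1 by rewrite ger0_norm.
  apply: is_deriveD.
  - apply: (@line_is_derive (fun u => L u y1)).
    by have [] := H _ _ (inb x _ _ hrho t1') ky.
  - apply: (@line_is_derive (fun u => L u y2)).
    by have [] := H _ _ (inb x _ _ hrho' t1') ky'.
have t1' : `|t| <= 1 by rewrite ger0_norm.
have tx := inb x _ _ hrho t1'.
set xp := x + (t * h) *: r in tx E *; set xm := x + (t * - h) *: r in E *.
have inx (j : R) : 0 <= j <= 1 -> `|xm + (j * (2 * t * h)) *: r - x| < rho.
  move=> /andP[j0 j1].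
  have -> : xm + (j * (2 * t * h)) *: r = x + ((t * (2 * j - 1)) * h) *: r.
    by rewrite -addrA -scalerDl; congr (_ + _ *: _); ring.
  apply: inb => //.
  by rewrite normrM ger0_norm// mulr_ile1// ler_norml; apply/andP; split; lra.
have iny (i : R) : 0 <= i <= 1 -> `|y2 + (i * (2 * k)) *: r - y| < rho.
  move=> /andP[i0 i1].
  have -> : y2 + (i * (2 * k)) *: r = y + ((2 * i - 1) * k) *: r.
    by rewrite -addrA -scalerDl; congr (_ + _ *: _); ring.
  apply: inb => //.
  by rewrite ler_norml; apply/andP; split; lra.
(* The difference G(xp, y1) - G(xm, y2) passes through G(xp, y2): one leg moves x and uses [A], the
   other moves y and uses [B]. *)
have [j j01|j j01 Ex] := @line_MVT (fun u => G u y2) xm r (2 * t * h) (A ^~ y2).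
  by have [] := H _ _ (inx j j01) ky'.
have [i i01|i i01 Ey] := @line_MVT (G xp) y2 r (2 * k) (B xp).
  by have [] := H _ _ tx (iny i i01).
have [_ _ _ [bA _]] := H _ _ (inx j j01) ky'.
have [_ _ _ [_ bB]] := H _ _ tx (iny i i01).
have xE : xm + (2 * t * h) *: r = xp.
  by rewrite -addrA -scalerDl; congr (_ + _ *: _); ring.
have yE : y2 + (2 * k) *: r = y1.
  by rewrite -addrA -scalerDl; congr (_ + _ *: _); ring.
rewrite {}xE in Ex; rewrite {}yE in Ey.
move: E; rewrite /xp /xm !mul1r !mul0r !scale0r !addr0 -/xp -/xm => E.
have y2E : y - k *: r = y2 by rewrite /y2 scaleNr.
rewrite y2E -scaleNr.
set X := A _ _ in Ex bA; set Y := B _ _ in Ey bB.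
have -> : L (x + h *: r) y1 - L x y1 + (L (x + (- h) *: r) y2 - L x y2) =
  h * (X * (2 * t * h) + Y * (2 * k)).
  rewrite -Ex -Ey; lra.
apply: le_trans (ler_norm _) _.
rewrite normrM (le_trans (ler_wpM2l (normr_ge0 h) (ler_normD _ _)))//.
rewrite !normrM (ger0_norm t0) normr_nat.
have M0 : 0 <= M by exact: le_trans (normr_ge0 _) bA.
have -> : h ^+ 2 = `|h| * `|h| by rewrite -expr2 real_normK// num_real.
have -> : 2 * M * (`|h| * `|h| + `|h| * `|k|) =
  `|h| * (M * (2 * 1 * `|h|) + M * (2 * `|k|)) by ring.
rewrite ler_wpM2l// lerD//; last by rewrite ler_wpM2r// mulr_ge0.
by rewrite ler_pM// ?mulr_ge0// ler_wpM2r// ler_wpM2l.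
Qed.

Lemma mixed_difference_le (L : V -> V -> R) x y r (rho M h k : R) :
  (forall x' y', `|x' - x| < rho -> `|y' - y| < rho ->
     [/\ partially_derivable (fun u => L u y') x',
         {for x', continuous (grad (fun u => L u y'))},
         partially_derivable (fun u => grad (fun w => L w y') u) x' /\
         {for x', continuous (jac (grad (fun u => L u y')))},
         partially_derivable (fun w => grad (fun u => L u w) x') y' /\
         {for y', continuous (jac (fun w => grad (fun u => L u w) x'))}
       & `|dotp (jac (grad (fun u => L u y')) x' *m r) r| <= M /\
         `|dotp (jac (fun w => grad (fun u => L u w) x') y' *m r) r| <= M]) ->
  `|h *: r| < rho -> `|k *: r| < rho ->
  L (x + h *: r) (y + k *: r) - L x (y + k *: r) +
  (L (x - h *: r) (y - k *: r) - L x (y - k *: r)) <=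
  2 * M * (h ^+ 2 + `|h| * `|k|).
Proof.
move=> H; apply: (@mixed_difference_abs _
  (fun x' y' => dotp (grad (fun u => L u y') x') r)
  (fun x' y' => dotp (jac (grad (fun u => L u y')) x' *m r) r)
  (fun x' y' => dotp (jac (fun w => grad (fun u => L u w) x') y' *m r) r)).
move=> x' y' x'x y'y.
have [_ cg [_ cxx] [_ cxy] bnd] := H _ _ x'x y'y.
have ex : 0 < rho - `|x' - x| by rewrite subr_gt0.
have ey : 0 < rho - `|y' - y| by rewrite subr_gt0.
split; last exact: bnd.
- apply: (is_derive_C1 _ ex) => [z zx'|]; last exact: cg.
  by have [] := H z y' (ball_shrink x'x zx') y'y.
- apply: (is_derive_field _ _ ex) => [z zx'|]; last exact: cxx.
  by have [_ _ []] := H z y' (ball_shrink x'x zx') y'y.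
- apply: (is_derive_field _ _ ey) => [z zy'|]; last exact: cxy.
  by have [_ _ _ []] := H x' z x'x (ball_shrink y'y zy').
Qed.

End DirectionalCalculus.

(** * Finite exceptional sets *)

Section FiniteExceptionalSets.
Context {R : realType}.
Implicit Types (S : seq R) (D : set R) (f : R -> R).

Lemma finite_measurable (B : set R) : finite_set B -> measurable B.
Proof.
move=> /finite_seqP[S ->]; elim: S => [|x S IH]; first by rewrite set_nil.
have -> : [set` x :: S] = [set x] `|` [set` S].
  apply/seteqP; split=> y /=; rewrite inE; first by move=> /predU1P.
  by move=> /predU1P.
exact: measurableU.
Qed.

Lemma measurable_seq S : measurable ([set` S] : set R).
Proof. by apply: finite_measurable; exact: finite_seq. Qed.

Lemma lebesgue_measure_seq S : @lebesgue_measure R [set` S] = 0%E.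
Proof. by apply: countable_lebesgue_measure0; exact/finite_set_countable/finite_seq. Qed.

(** Preimages inside a finite set are finite, so the default values of [caputo] at exceptional
    points cannot spoil measurability. *)
Lemma measurable_fun_off_seq S D f : measurable D ->
  measurable_fun (D `\` [set` S]) f -> measurable_fun D f.
Proof.
move=> mD mf; have mS := measurable_seq S.
rewrite -(setDUK (@subIsetl _ D [set` S])) setDIr setDv set0U setUC.
apply/measurable_funU; [exact: measurableD|exact: measurableI|split=> //].
move=> _ Y mY; apply: finite_measurable.
by apply: sub_finite_set (finite_seq S) => x [[_ ]].
Qed.

End FiniteExceptionalSets.

(** * Tubes around a path and slices of neighborhoods *)

Section Neighborhoods.
Context {R : realType} {n : nat}.
Local Notation V := 'cV[R]_n.
Implicit Types (x y : R -> V).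

Lemma near_point (t : R) (xi upsilon : V) (Q : R * V * V -> Prop) :
  (\forall p \near (t, xi, upsilon), Q p) ->
  exists2 rho : R, 0 < rho & forall s u v, `|s - t| < rho -> `|u - xi| < rho ->
    `|v - upsilon| < rho -> Q (s, u, v).
Proof.
move=> /nbhs_ballP[e /= e0 eP]; exists e => // s u v st ux vy.
apply: eP; split; first split; rewrite -ball_normE/= distrC//.
Qed.

(** A neighborhood of the limit point becomes tubes of fixed radius around the path. The filter is
    arbitrary, so that full and one-sided limits are treated alike. *)
Lemma near_path (F : set_system R) x y (t : R) (xi upsilon : V)
    (Q : R * V * V -> Prop) : Filter F ->
  s @[s --> F] --> t -> x s @[s --> F] --> xi -> y s @[s --> F] --> upsilon ->
  (\forall p \near (t, xi, upsilon), Q p) ->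
  exists2 rho : R, 0 < rho & \forall s \near F, forall u v,
    `|u - x s| < rho -> `|v - y s| < rho -> Q (s, u, v).
Proof.
move=> FF /cvgrPdist_lt ct /cvgrPdist_lt cx /cvgrPdist_lt cy.
move=> /near_point[e e0 eP]; have e20 : 0 < e / 2 by lra.
exists (e / 2) => //.
have tri (w z1 z2 : V) : `|z1 - w| < e / 2 -> `|z2 - w| < e / 2 -> `|z2 - z1| < e.
  move=> h1 h2; rewrite -(subrK w z2) -addrA (le_lt_trans (ler_normD _ _))//.
  by rewrite [`|w - z1|]distrC; lra.
apply: filterS3 (ct _ e0) (cx _ e20) (cy _ e20) => s st sx sy u v ux vy.
by apply: eP; [rewrite distrC|exact: tri sx ux|exact: tri sy vy].
Qed.

Lemma within_continuous_near (W : normedModType R) (A : set (R * V * V))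
    (G : R * V * V -> W) p (e : R) : {within A, continuous G} -> A p -> 0 < e ->
  \forall p' \near p, A p' -> `|G p - G p'| < e.
Proof.
move=> /subspace_continuousP cG Ap e0.
by have /cvgrPdist_lt/(_ _ e0) := cG _ Ap; rewrite near_withinE.
Qed.

(** Continuity is only relative to the strip t0 <= t <= t1, but with [t] frozen the whole slice lies
    in the strip and [U] is open. *)
Lemma slice_x_continuous (W : topologicalType) (t0 t1 : R) (U : set (R * V * V))
    (G : R * V * V -> W) (t : R) (u v : V) :
  open U -> {within U `&` [set p | t0 <= p.1.1 <= t1], continuous G} ->
  t0 <= t <= t1 -> U (t, u, v) -> {for u, continuous (fun u' => G (t, u', v))}.
Proof.
move=> oU /subspace_continuousP cG tin Up.
have {}cG := cG (t, u, v) (conj Up tin).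
apply: (@cvg_comp _ _ _ (fun u' => (t, u', v)) G _ _ _ _ cG).
move=> P; rewrite /within/= => nP.
have nU : nbhs (t, u, v) U by exact: open_nbhs_nbhs.
have : nbhs (t, u, v) [set p | U p /\ (U p /\ t0 <= p.1.1 <= t1 -> P p)].
  exact: filterI.
move=> /near_point[rho rho0 rhoP].
apply: filterS (nbhsx_ballx u rho rho0) => u'; rewrite -ball_normE/= distrC => uu'.
have [||Uu' +] := rhoP t u' v _ uu'; [by rewrite subrr normr0..|].
by apply.
Qed.

Lemma slice_y_continuous (W : topologicalType) (t0 t1 : R) (U : set (R * V * V))
    (G : R * V * V -> W) (t : R) (u v : V) :
  open U -> {within U `&` [set p | t0 <= p.1.1 <= t1], continuous G} ->
  t0 <= t <= t1 -> U (t, u, v) -> {for v, continuous (fun v' => G (t, u, v'))}.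
Proof.
move=> oU /subspace_continuousP cG tin Up.
have {}cG := cG (t, u, v) (conj Up tin).
apply: (@cvg_comp _ _ _ (fun v' => (t, u, v')) G _ _ _ _ cG).
move=> P; rewrite /within/= => nP.
have nU : nbhs (t, u, v) U by exact: open_nbhs_nbhs.
have : nbhs (t, u, v) [set p | U p /\ (U p /\ t0 <= p.1.1 <= t1 -> P p)].
  exact: filterI.
move=> /near_point[rho rho0 rhoP].
apply: filterS (nbhsx_ballx v rho rho0) => v'; rewrite -ball_normE/= distrC => vv'.
have [||Uv' +] := rhoP t u v' _ _ vv'; [by rewrite subrr normr0..|].
by apply.
Qed.

End Neighborhoods.

(** * Uniform bounds on the Lagrangian along the trajectory *)

Section LagrangianBounds.
Context {R : realType} {n : nat}.
Local Notation V := 'cV[R]_n.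
Context (t0 t1 : R) (L : R -> V -> V -> R) (U : set (R * V * V)) (r : V).
Local Notation A := (U `&` [set p | t0 <= p.1.1 <= t1]).

Definition lagrangian_bounded (M : R) (p : R * V * V) : Prop :=
  U p /\ [/\ `|L p.1.1 p.1.2 p.2| <= M,
    `|dotp (L_xx L p.1.1 p.1.2 p.2 *m r) r| <= M,
    `|dotp (L_xy L p.1.1 p.1.2 p.2 *m r) r| <= M
  & `|dotp (L_yy L p.1.1 p.1.2 p.2 *m r) r| <= M].

Lemma lagrangian_bounded_le (M N : R) p : M <= N ->
  lagrangian_bounded M p -> lagrangian_bounded N p.
Proof.
move=> MN [Up [b1 b2 b3 b4]]; split; first exact: Up.
by split; [exact: (le_trans b1)|exact: (le_trans b2)|exact: (le_trans b3)|
  exact: (le_trans b4)].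
Qed.

Lemma form_within_continuous (G : R * V * V -> 'M[R]_n) (B : set (R * V * V)) :
  {within B, continuous G} ->
  {within B, continuous (fun p => dotp (G p *m r) r)}.
Proof.
move=> /subspace_continuousP cG; apply/subspace_continuousP => p Bp.
apply: (@cvg_comp _ _ _ G (fun M : 'M[R]_n => dotp (M *m r) r) _ (nbhs (G p))).
  exact: cG.
exact: mx_form_continuous.
Qed.

Lemma lagrangian_bounded_near p : open U -> lagrangian_C2_on L A ->
  U p -> t0 <= p.1.1 <= t1 ->
  exists2 M : R, 0 < M &
    \forall p' \near p, t0 <= p'.1.1 <= t1 -> lagrangian_bounded M p'.
Proof.
move=> oU [_ [cL _ _ cxx [cxy cyy]]] Up pin; have Ap : A p by [].
have nU : nbhs p U by exact: open_nbhs_nbhs.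
have bnd (G : R * V * V -> R) : {within A, continuous G} -> exists2 M : R, 0 < M &
    \forall p' \near p, t0 <= p'.1.1 <= t1 -> `|G p'| <= M.
  move=> cG; exists (`|G p| + 1); first by rewrite ltr_wpDl.
  apply: filterS2 nU (within_continuous_near cG Ap ltr01) => p' Up' H p'in.
  have {}H := H (conj Up' p'in).
  rewrite -(subrK (G p) (G p')) (le_trans (ler_normD _ _))// addrC lerD2l.
  by rewrite distrC ltW.
have [M1 M10 H1] := bnd _ cL.
have [M2 M20 H2] := bnd _ (form_within_continuous cxx).
have [M3 M30 H3] := bnd _ (form_within_continuous cxy).
have [M4 M40 H4] := bnd _ (form_within_continuous cyy).
have N1 : M1 <= M1 + M2 + M3 + M4 by lra.
have N2 : M2 <= M1 + M2 + M3 + M4 by lra.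
have N3 : M3 <= M1 + M2 + M3 + M4 by lra.
have N4 : M4 <= M1 + M2 + M3 + M4 by lra.
exists (M1 + M2 + M3 + M4); first by lra.
apply: filterS2 nU (filterI H1 (filterI H2 (filterI H3 H4))).
move=> p' Up' [h1 [h2 [h3 h4]]] p'in; split; first exact: Up'.
by split; [exact: (le_trans (h1 p'in))|exact: (le_trans (h2 p'in))|
  exact: (le_trans (h3 p'in))|exact: (le_trans (h4 p'in))].
Qed.

(** One number serves as tube radius and, inverted, as bound. The property then passes to smaller
    radii, and compactness in its near-covering form, applied to the filter of small positive radii,
    gives a common one. *)
Lemma lagrangian_bounded_uniform (x y : R -> V) (S : seq R) :
  open U -> lagrangian_C2_on L A -> {within `[t0, t1], continuous x} ->
  (forall t, t0 <= t <= t1 ->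
    (U (t, x t, y t) /\ y s @[s --> within `[t0, t1] (nbhs t)] --> y t) \/
    [/\ t \in S, t0 < t < t1,
      (exists2 yl, U (t, x t, yl) & y s @[s --> t^'-] --> yl) &
      (exists2 yr, U (t, x t, yr) & y s @[s --> t^'+] --> yr)]) ->
  exists2 rho : R, 0 < rho & forall s, t0 <= s <= t1 -> s \notin S ->
    forall u v, `|u - x s| < rho -> `|v - y s| < rho ->
      lagrangian_bounded rho^-1 (s, u, v).
Proof.
move=> oU LC2 /subspace_continuousP cx loc.
pose P (rho : R) s := t0 <= s <= t1 -> s \notin S -> forall u v,
  `|u - x s| < rho -> `|v - y s| < rho -> lagrangian_bounded rho^-1 (s, u, v).
have P_le rho rho' s : 0 < rho' -> rho' <= rho -> P rho s -> P rho' s.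
  move=> rho'0 rr Prho sin sS u v us vs.
  apply: (@lagrangian_bounded_le rho^-1).
    by rewrite lef_pV2// posrE; exact: lt_le_trans rr.
  by apply: Prho => //; exact: lt_le_trans rr.
have path (F : set_system R) t yt : Filter F -> t0 <= t <= t1 -> U (t, x t, yt) ->
    s @[s --> F] --> t -> x s @[s --> F] --> x t -> y s @[s --> F] --> yt ->
    exists2 rho : R, 0 < rho & \forall s \near F, P rho s.
  move=> FF tin Ut ct cxt cyt.
  have [M M0 MP] := @lagrangian_bounded_near (t, x t, yt) oU LC2 Ut tin.
  have [rho rho0 rhoP] := near_path FF ct cxt cyt MP.
  have m0 : 0 < Num.min rho M^-1 by rewrite lt_min rho0 invr_gt0.
  exists (Num.min rho M^-1) => //.
  apply: filterS rhoP => s sP sin sS u v; rewrite !lt_min => /andP[us _] /andP[vs _].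
  apply: (@lagrangian_bounded_le M); last exact: sP.
  by rewrite -[leLHS]invrK lef_pV2 ?posrE ?invr_gt0// ge_min lexx orbT.
have loc' t : t0 <= t <= t1 ->
    exists2 rho : R, 0 < rho & \forall s \near t, P rho s.
  move=> tin; have [[Ut cyt]|[tS tin' [yl Ul cl] [yr Ur cr]]] := loc _ tin.
    have [|||rho rho0] := path (within `[t0, t1] (nbhs t)) t (y t) _ tin Ut.
    + by apply: cvg_within_filter.
    + by apply: cx; rewrite /= in_itv.
    + exact: cyt.
    rewrite near_withinE => rhoP; exists rho => //.
    by apply: filterS rhoP => s sP sin; apply: sP.
  have /andP[t0t tt1] := tin'.
  have cxt : x s @[s --> within `[t0, t1] (nbhs t)] --> x t.
    by apply: cx; rewrite /= in_itv.
  have [||rl rl0 rlP] := path t^'- t yl _ tin Ul _ _ cl.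
  + by apply: cvg_within_filter.
  + apply: cvg_trans cxt; apply: cvg_app; apply: within_at_left.
    by rewrite t0t ltW.
  have [||rr rr0 rrP] := path t^'+ t yr _ tin Ur _ _ cr.
  + by apply: cvg_within_filter.
  + apply: cvg_trans cxt; apply: cvg_app; apply: within_at_right.
    by rewrite tt1 ltW.
  have m0 : 0 < Num.min rl rr by rewrite lt_min rl0.
  exists (Num.min rl rr) => //.
  move: rlP rrP; rewrite !near_withinE => rlP rrP.
  apply: filterS2 rlP rrP => s sl sr.
  (* At a jump each side has its own tube, around its own one-sided limit; the point [t] itself is
     in [S] and excluded. *)
  have [st|ts|->] := ltgtP s t.
  + by apply: P_le (sl st) => //; rewrite ge_min lexx.
  + by apply: P_le (sr ts) => //; rewrite ge_min lexx orbT.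
  + by move=> _; rewrite tS.
have cK := @segment_compact R t0 t1.
have /(_ R (0 : R)^'+ P) := (near_covering_withinP _).2
  ((compact_near_coveringP _).1 cK).
move=> /(_ _ _)[].
  move=> t; rewrite /= in_itv/= => tin.
  have [rho rho0 rhoP] := loc' _ tin.
  exists ([set s | P rho s], [set i | 0 < i <= rho]) => /=.
    split; first exact: rhoP.
    near=> i; apply/andP; split; first by near: i; exact: nbhs_right_gt.
    by near: i; exact: nbhs_right_le.
  move=> [s i] /= [Ps /andP[i0 irho]] _; exact: P_le Ps.
move=> e /= e0 eP; exists (e / 2); first by rewrite divr_gt0.
move=> s sin; apply: (eP (e / 2)) => //.
- by rewrite /ball/= sub0r normrN gtr0_norm ?divr_gt0//; lra.
- by rewrite divr_gt0.
Unshelve. all: by end_near. Qed.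

(** Split into the second difference of L(t, u, .) and the two increments in x taken at v + k r and
    v - k r. Thus the sign of L_yy is used only over the base point [u]. *)
Lemma lagrangian_second_difference (t : R) (u v : V) (rho M c h k : R) :
  open U -> lagrangian_C2_on L A -> t0 <= t <= t1 ->
  (forall u' v', `|u' - u| < rho -> `|v' - v| < rho ->
    lagrangian_bounded M (t, u', v')) ->
  (forall v', `|v' - v| < rho -> dotp (L_yy L t u v' *m r) r <= c) ->
  `|h *: r| < rho -> `|k *: r| < rho ->
  L t (u + h *: r) (v + k *: r) + L t (u - h *: r) (v - k *: r) - 2 * L t u v <=
  2 * M * (h ^+ 2 + `|h| * `|k|) + c * k ^+ 2.
Proof.
move=> oU [dL [_ cx cy cxx [cxy cyy]]] tin bnd cyyle hrho krho.
have rho0 : 0 < rho by exact: le_lt_trans hrho.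
have uu : `|u - u| < rho by rewrite subrr normr0.
have mix := @mixed_difference_le R n (L t) u v r rho M h k _ hrho krho.
have sec := @second_difference_le R n (L t u) v r rho c k _ krho.
have {}sec : L t u (v + k *: r) + L t u (v - k *: r) - 2 * L t u v <= c * k ^+ 2.
  apply: sec => v' v'v.
  have [Up _] := bnd u v' uu v'v.
  have [_ d2 _ _ d5] := dL _ _ _ (conj Up tin).
  split; [exact: d2| |exact: d5| |exact: cyyle].
  - exact: (slice_y_continuous oU cy tin Up).
  - exact: (slice_y_continuous oU cyy tin Up).
have {}mix : L t (u + h *: r) (v + k *: r) - L t u (v + k *: r) +
  (L t (u - h *: r) (v - k *: r) - L t u (v - k *: r)) <=
  2 * M * (h ^+ 2 + `|h| * `|k|).
  apply: mix => u' v' u'u v'v.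
  have [Up [_ b2 b3 _]] := bnd u' v' u'u v'v.
  have [d1 _ d3 d4 _] := dL _ _ _ (conj Up tin).
  split; [exact: d1| | | |split; [exact: b2|exact: b3]].
  - exact: (slice_x_continuous oU cx tin Up).
  - split; first exact: d3.
    exact: (slice_x_continuous oU cxx tin Up).
  - split; first exact: d4.
    exact: (slice_y_continuous oU cxy tin Up).
lra.
Qed.

End LagrangianBounds.

(** * Integrability of the cost integrand *)

Section RealIntegrableClosure.
Context {R : realType}.
Local Notation mu := (@lebesgue_measure R).

Lemma integrable_scale (D : set R) (f : R -> R) (c : R) : measurable D ->
  mu.-integrable D (EFin \o f) -> mu.-integrable D (EFin \o (fun s => c * f s)).
Proof.
move=> mD fi.
have H : mu.-integrable D (fun x => c%:E * (EFin \o f) x)%E by exact: integrableZl.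
by apply: eq_integrable H.
Qed.

Lemma integrable_add (D : set R) (f g : R -> R) : measurable D ->
  mu.-integrable D (EFin \o f) -> mu.-integrable D (EFin \o g) ->
  mu.-integrable D (EFin \o (fun s => f s + g s)).
Proof.
move=> mD fi gi.
have H : mu.-integrable D ((EFin \o f) \+ (EFin \o g))%E by exact: integrableD.
by apply: eq_integrable H.
Qed.

End RealIntegrableClosure.

Section CostIntegrability.
Context {R : realType} {n : nat}.
Local Notation mu := (@lebesgue_measure R).
Local Notation V := 'cV[R]_n.

Lemma cost_integrable (t0 t1 b M : R) (L : R -> V -> V -> R)
    (U : set (R * V * V)) (x y : R -> V) (S : seq R) : 0 < b ->
  {within U `&` [set p | t0 <= p.1.1 <= t1],
    continuous (fun p => L p.1.1 p.1.2 p.2)} ->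
  {within `[t0, t1], continuous x} ->
  (forall s, t0 <= s <= t1 -> s \notin S ->
    [/\ y u @[u --> within `[t0, t1] (nbhs s)] --> y s, U (s, x s, y s)
      & `|L s (x s) (y s)| <= M]) ->
  mu.-integrable `[t0, t1]
    (EFin \o (fun s => (t1 - s) `^ (b - 1) * L s (x s) (y s))).
Proof.
move=> b0 /subspace_continuousP cL /subspace_continuousP cx H.
pose f s := L s (x s) (y s).
have Ein s : (`[t0, t1] `\` [set` S]) s -> t0 <= s <= t1 /\ s \notin S.
  by move=> [/=]; rewrite in_itv/= => sin /negP sS; split.
(* The sum over [S] bounds the uncontrolled values at the exceptional points. *)
apply: (@integrable_mul_bounded _ _ _ f (`|M| + \sum_(s <- S) `|f s|)) => //.
- by apply: integrable_subr_powR; lra.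
- apply: (measurable_fun_off_seq (S := S)) => //.
  apply: subspace_continuous_measurable_fun.
    by apply: measurableD => //; exact: measurable_seq.
  apply/subspace_continuousP => s /[dup] sE /Ein[sin sS].
  have [cy Us _] := H _ sin sS.
  have {}cL := cL (s, x s, y s) (conj Us sin).
  have FE : Filter (within (`[t0, t1] `\` [set` S]) (nbhs s)).
    exact: within_filter.
  have sub : within (`[t0, t1] `\` [set` S]) (nbhs s) --> within `[t0, t1] (nbhs s).
    by apply: within_subset; exact: subDsetl.
  apply: (@cvg_comp _ _ _ (fun u => (u, x u, y u)) (fun p => L p.1.1 p.1.2 p.2)
    _ _ _ _ cL).
  move=> P; rewrite /within/= => nP.
  have ct : u @[u --> within (`[t0, t1] `\` [set` S]) (nbhs s)] --> s.
    by apply: cvg_within_filter.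
  have cxE : x u @[u --> within (`[t0, t1] `\` [set` S]) (nbhs s)] --> x s.
    by apply: cvg_trans (cvg_app _ sub) _; apply: cx; rewrite /= in_itv.
  have cyE : y u @[u --> within (`[t0, t1] `\` [set` S]) (nbhs s)] --> y s.
    by apply: cvg_trans (cvg_app _ sub) _; exact: cy.
  have [rho rho0] := near_path FE ct cxE cyE nP.
  rewrite near_withinE; apply: filterS => u uP uE.
  have [uin uS] := Ein _ uE; have [_ Uu _] := H _ uin uS.
  by apply: (uP uE); rewrite ?subrr ?normr0//; split.
- move=> s /=; rewrite in_itv/= => sin.
  have [sS|sS] := boolP (s \in S); last first.
    have [_ _ h] := H _ sin sS; apply: le_trans h _.
    by rewrite (le_trans (ler_norm _))// lerDl sumr_ge0.
  rewrite (big_rem s)//= [`|M| + _]addrC -addrA lerDl addr_ge0//.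
  by rewrite sumr_ge0.
Qed.

End CostIntegrability.

(** * Weighted estimates for the bump and the pulse *)

Section WeightBounds.
Context {R : realType}.
Local Notation mu := (@lebesgue_measure R).
Implicit Types (a b e s t ts : R).

(** The exponent b - 1 of the weight may have either sign; min and max treat both monotonicities
    together. *)
Lemma powR_between (p u z v : R) : 0 < u -> u <= z -> z <= v ->
  Num.min (u `^ p) (v `^ p) <= z `^ p <= Num.max (u `^ p) (v `^ p).
Proof.
move=> u0 uz zv; have z0 : 0 < z by exact: lt_le_trans uz.
have v0 : 0 < v by exact: lt_le_trans zv.
rewrite ge_min le_max; have [p0|p0] := leP 0 p.
  apply/andP; split; apply/orP; [left|right];
    by apply: ge0_ler_powR; rewrite ?nnegrE// ltW.
have [q q0 ->] : exists2 q, 0 <= q & p = - q by exists (- p); lra.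
apply/andP; split; apply/orP; [right|left]; rewrite !powRN;
  rewrite lef_pV2 ?posrE ?powR_gt0//;
  by apply: ge0_ler_powR; rewrite ?nnegrE// ltW.
Qed.

Lemma bump_ge0 a ts e s : 0 <= a -> 0 <= e -> 0 <= bump a ts e s.
Proof. by move=> a0 e0; rewrite /bump subr_ge0 ppow_homo//; lra. Qed.

Lemma bump_le a ts e s : 0 < a <= 1 -> 0 <= e -> bump a ts e s <= e `^ a.
Proof.
move=> a01 e0; rewrite /bump.
by have := ppow_holder (s - ts - e) a01 e0; rewrite subrK.
Qed.

Lemma bump_le_far a ts e s m : 0 < a <= 1 -> 0 <= e -> ts < m -> m <= s ->
  e <= (m - ts) / 2 -> bump a ts e s <= ((m - ts) / 2) `^ (a - 1) * e.
Proof.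
move=> a01 e0 tsm ms em; rewrite /bump.
have d0 : 0 < s - ts - e by lra.
have := ppow_lipschitz a01 d0 e0; rewrite subrK => /le_trans; apply.
rewrite ler_wpM2r//; have -> : a - 1 = - (1 - a) by lra.
rewrite !powRN lef_pV2 ?posrE ?powR_gt0//; last by lra.
by apply: ge0_ler_powR; rewrite ?nnegrE; lra.
Qed.

Lemma measurable_bump a ts e (D : set R) : 0 < a <= 1 ->
  measurable_fun D (bump a ts e).
Proof.
by move=> a01; apply: measurable_funTS; apply: continuous_measurable_fun;
  exact: bump_continuous.
Qed.

Lemma bump_weight_bound a b t0 t1 ts : 0 < a <= 1 -> 0 < b -> t0 <= ts -> ts < t1 ->
  exists2 C : R, 0 <= C & forall e, 0 < e -> e <= (t1 - ts) / 4 ->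
    [/\ bump a ts e t1 <= C * e,
        mu.-integrable `[t0, t1] (EFin \o (fun s => (t1 - s) `^ (b - 1) *
          `|bump a ts e s - bump a ts e t1|))
      & \int[mu]_(s in `[t0, t1]) ((t1 - s) `^ (b - 1) *
          `|bump a ts e s - bump a ts e t1|) <= C * e].
Proof.
move=> a01 b0 t0ts tst1; have /andP[a0 a1] := a01.
pose m := (ts + t1) / 2; pose W s := (t1 - s) `^ (b - 1).
have tsm : ts < m by rewrite /m; lra.
have mt1 : m < t1 by rewrite /m; lra.
have W0 s : 0 <= W s by exact: powR_ge0.
have iW : mu.-integrable `[t0, t1] (EFin \o W).
  by apply: integrable_subr_powR; lra.
pose IW := \int[mu]_(s in `[t0, t1]) W s.
have IW0 : 0 <= IW by exact: Rintegral_ge0.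
pose Wm := Num.max ((t1 - m) `^ (b - 1)) ((t1 - t0) `^ (b - 1)).
have WWm s : t0 <= s <= m -> W s <= Wm.
  move=> /andP[t0s sm].
  by have /andP[_] := @powR_between (b - 1) (t1 - m) (t1 - s) (t1 - t0)
    ltac:(lra) ltac:(lra) ltac:(lra).
have Wm0 : 0 <= Wm by rewrite le_max powR_ge0.
pose C1 := ((m - ts) / 2) `^ (a - 1).
have C10 : 0 <= C1 by exact: powR_ge0.
have p0 := ppow_ge0 a (m - ts).
(* The first [C1] bounds the bump at [t1]. In the integral, |u - u(t1)| <= u + u(t1): up to [m] the
   weight is at most [Wm] and u integrates to O(e); beyond [m], u <= C1 e against an integrable
   weight; the last term comes from u(t1). *)
pose C := C1 + (Wm * ppow a (m - ts) + C1 * IW + C1 * IW).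
have CC : 0 <= Wm * ppow a (m - ts) + C1 * IW + C1 * IW.
  by rewrite !addr_ge0// mulr_ge0.
exists C; first by rewrite addr_ge0.
move=> e e0 ee; have em : e <= (m - ts) / 2 by rewrite /m; lra.
have u0 s : 0 <= bump a ts e s by apply: bump_ge0; exact: ltW.
have uf s : m <= s -> bump a ts e s <= C1 * e.
  by move=> ms; apply: bump_le_far => //; exact: ltW.
have ub s : bump a ts e s <= e `^ a by apply: bump_le => //; exact: ltW.
have d1 := uf _ (ltW mt1).
have iWu : mu.-integrable `[t0, t1] (EFin \o (fun s => W s * bump a ts e s)).
  apply: (@integrable_mul_bounded _ _ _ _ (e `^ a)) => //.
  - exact: measurable_bump.
  - by move=> s _; rewrite ger0_norm.
have iWg : mu.-integrable `[t0, t1]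
    (EFin \o (fun s => W s * `|bump a ts e s - bump a ts e t1|)).
  apply: (@integrable_mul_bounded _ _ _ _ (e `^ a + e `^ a)) => //.
  - apply: measurableT_comp => //; apply: measurable_funB => //.
    exact: measurable_bump.
  - move=> s _; rewrite normr_id (le_trans (ler_normB _ _))//.
    by rewrite !ger0_norm// lerD.
split=> //.
  by rewrite (le_trans d1)// ler_wpM2r ?(ltW e0)// lerDl.
rewrite -/W.
pose h s := W s * bump a ts e s + bump a ts e t1 * W s.
have ih2 : mu.-integrable `[t0, t1] (EFin \o (fun s => bump a ts e t1 * W s)).
  exact: integrable_scale.
apply: (@le_trans _ _ (\int[mu]_(s in `[t0, t1]) h s)).
  apply: le_Rintegral => //.
    exact: integrable_add.
  move=> s _; rewrite /h [bump a ts e t1 * _]mulrC -mulrDr ler_wpM2l ?powR_ge0//.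
  by rewrite (le_trans (ler_normB _ _))// !ger0_norm.
rewrite /h RintegralD// RintegralZl// -/IW.
have HI : \int[mu]_(s in `[t0, t1]) (W s * bump a ts e s) <=
    (Wm * ppow a (m - ts) + C1 * IW) * e.
  pose k s := Wm * ((bump a ts e \_ `[t0, m]) s) + C1 * e * W s.
  have iu : mu.-integrable `[t0, m] (EFin \o bump a ts e).
    apply: continuous_compact_integrable; first exact: segment_compact.
    by apply: continuous_subspaceT => s; exact: bump_continuous.
  have sub : `[t0, m] `<=` `[t0, t1].
    by move=> s /=; rewrite !in_itv/= => /andP[-> /le_trans->//]; exact: ltW.
  have iu' : mu.-integrable `[t0, t1] (EFin \o (bump a ts e \_ `[t0, m])).
    rewrite -restrict_EFin; apply/integrable_restrict => //=.
    by rewrite setIidr.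
  have ik1 : mu.-integrable `[t0, t1]
      (EFin \o (fun s => Wm * ((bump a ts e \_ `[t0, m]) s))).
    exact: integrable_scale.
  have ik2 : mu.-integrable `[t0, t1] (EFin \o (fun s => C1 * e * W s)).
    exact: integrable_scale.
  apply: (@le_trans _ _ (\int[mu]_(s in `[t0, t1]) k s)).
    apply: le_Rintegral => //.
      exact: integrable_add.
    move=> s /=; rewrite in_itv/= => /andP[t0s st1]; rewrite /k patchE.
    have [sm|ms] := leP s m.
      rewrite ifT; last by rewrite inE/= in_itv/= t0s.
      have := @ler_wpM2r _ _ (u0 s) _ _ (WWm s _); rewrite t0s sm => /(_ isT).
      move=> /le_trans; apply; rewrite lerDl !mulr_ge0//; exact: ltW.
    rewrite ifF; last first.
      by apply/negbTE; rewrite notin_setE/= in_itv/= [s <= m]leNgt ms andbF.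
    rewrite mulr0 add0r [leRHS]mulrC ler_wpM2l//; apply: uf; exact: ltW.
  rewrite /k RintegralD// !RintegralZl// -Rintegral_mkcondr setIidr//.
  rewrite -/IW mulrDl lerD//; last by rewrite mulrAC.
  rewrite -mulrA ler_wpM2l// mulrC; apply: Rintegral_ppow_shift_le => //.
  - exact: ltW.
  - by rewrite /m; lra.
have HW : bump a ts e t1 * IW <= C1 * IW * e by rewrite mulrAC ler_wpM2r.
apply: le_trans (lerD HI HW) _.
rewrite -mulrDl ler_wpM2r ?(ltW e0)// /C -[leLHS]add0r lerD//.
Qed.

Lemma pulse_weight_bound b t0 t1 ts : 0 < b -> t0 <= ts -> ts < t1 ->
  exists2 w : R, 0 < w & forall e, 0 < e -> e <= (t1 - ts) / 4 ->
    mu.-integrable `[t0, t1]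
      (EFin \o (fun s => (t1 - s) `^ (b - 1) * pulse ts e s)) /\
    w * e <= \int[mu]_(s in `[t0, t1]) ((t1 - s) `^ (b - 1) * pulse ts e s).
Proof.
move=> b0 t0ts tst1.
pose m := (ts + t1) / 2; pose W s := (t1 - s) `^ (b - 1).
(* For these [e] the pulse lives between [ts] and [m], where the weight is at least its smaller end
   value. *)
pose w := Num.min ((t1 - m) `^ (b - 1)) ((t1 - ts) `^ (b - 1)).
exists w; first by rewrite lt_min !powR_gt0//; rewrite /m; lra.
move=> e e0 ee.
have pulseE : pulse ts e = \1_(`]ts, ts + e[ : set R).
  apply/funext => s; rewrite /pulse indicE mem_setE in_itv/=.
  by case: ifP.
have i1 : mu.-integrable `[t0, t1] (EFin \o (fun s => W s * pulse ts e s)).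
  apply: (@integrable_mul_bounded _ _ _ _ 1) => //.
  - by apply: integrable_subr_powR; lra.
  - by rewrite pulseE; apply: measurable_funTS; exact: measurable_indic.
  - by move=> s _; rewrite /pulse; case: ifP; rewrite ?normr1 ?normr0.
split=> //.
have muI : fine (mu `]ts, (ts + e)%R[%classic) = e.
  by rewrite lebesgue_measure_itv/= lte_fin ltrDl e0/=; lra.
have := @Rintegral_ge_cst R `[t0, t1] `]ts, ts + e[ (fun s => W s * pulse ts e s) w.
rewrite muI; apply => //.
- by move=> s /=; rewrite !in_itv/= => /andP[? ?]; apply/andP; split; lra.
- by rewrite lebesgue_measure_itv/=; case: ifP => _; exact: ltry.
- by move=> s _; rewrite mulr_ge0 ?powR_ge0// /pulse; case: ifP.
- move=> s /=; rewrite in_itv/= => /[dup] sin /andP[s1 s2].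
  rewrite /pulse sin mulr1.
  by have /andP[] := @powR_between (b - 1) (t1 - m) (t1 - s) (t1 - ts)
    ltac:(rewrite /m; lra) ltac:(rewrite /m; lra) ltac:(lra).
Qed.

End WeightBounds.

(** * The second variation inequality *)

Section SecondVariation.
Context {R : realType}.
Local Notation mu := (@lebesgue_measure R).

Lemma second_variation_ge0 (D N : set R) (f fp fm g k : R -> R)
    (lam A B m l lp lm : R) :
  measurable D -> measurable N -> mu N = 0%E -> 0 < lam ->
  mu.-integrable D (EFin \o f) -> mu.-integrable D (EFin \o fp) ->
  mu.-integrable D (EFin \o fm) -> mu.-integrable D (EFin \o g) ->
  mu.-integrable D (EFin \o k) ->
  (forall s, D s -> ~ N s -> fp s + fm s - 2 * f s <=
    lam ^+ 2 * (B * g s - A * k s)) ->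
  \int[mu]_(s in D) f s + l <= \int[mu]_(s in D) fp s + lp ->
  \int[mu]_(s in D) f s + l <= \int[mu]_(s in D) fm s + lm ->
  lp + lm - 2 * l <= lam ^+ 2 * m ->
  0 <= B * \int[mu]_(s in D) g s - A * \int[mu]_(s in D) k s + m.
Proof.
move=> mD mN N0 lam0 fi fpi fmi gi ki pt Jp Jm lle.
have i1 : mu.-integrable D (EFin \o (fun s => fp s + fm s)).
  exact: integrable_add.
have i2 : mu.-integrable D (EFin \o (fun s => (- 2) * f s)).
  exact: integrable_scale.
have i3 : mu.-integrable D (EFin \o (fun s => lam ^+ 2 * B * g s)).
  exact: integrable_scale.
have i4 : mu.-integrable D (EFin \o (fun s => (- (lam ^+ 2 * A)) * k s)).
  exact: integrable_scale.
have : \int[mu]_(s in D) (fp s + fm s + (- 2) * f s) <=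
    \int[mu]_(s in D) (lam ^+ 2 * B * g s + (- (lam ^+ 2 * A)) * k s).
  apply: (le_Rintegral_off_null mD mN N0).
  - exact: (integrable_add mD i1 i2).
  - exact: (integrable_add mD i3 i4).
  - move=> s Ds Ns; have := pt s Ds Ns; lra.
rewrite !RintegralD// !RintegralZl// => le.
have : 0 <= lam ^+ 2 * (B * \int[mu]_(s in D) g s - A * \int[mu]_(s in D) k s + m).
  move: le Jp Jm lle; clear.
  set F := \int[mu]_(s in D) f s; set Fp := \int[mu]_(s in D) fp s.
  set Fm := \int[mu]_(s in D) fm s; set G := \int[mu]_(s in D) g s.
  set H := \int[mu]_(s in D) k s; set q := lam ^+ 2.
  clearbody F Fp Fm G H q => *; lra.
by rewrite pmulr_rge0// exprn_gt0.
Qed.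

(** Half of the curvature c K^2 on the pulse absorbs the cross term 2 M |g| K; the other half
    survives on the right. Off the pulse only g^2 <= ea |g| remains. *)
Lemma second_variation_integrand_le (W M lam g K kp ea c : R) :
  0 <= W -> 0 <= M -> 0 <= K -> kp = 0 \/ kp = 1 -> `|g| <= ea ->
  2 * M * K * ea <= c * K ^+ 2 / 2 ->
  W * (2 * M * ((lam * g) ^+ 2 + `|lam * g| * `|lam * K * kp|) +
    (if kp == 1 then - c else M) * (lam * K * kp) ^+ 2) <=
  lam ^+ 2 * (2 * M * ea * (W * `|g|) - c * K ^+ 2 / 2 * (W * kp)).
Proof.
move=> W0 M0 K0 kp01 gea small.
have gg : g ^+ 2 <= ea * `|g|.
  by rewrite -[g ^+ 2]real_normK ?num_real// expr2 ler_wpM2r.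
have l2 : 0 <= lam ^+ 2 by exact: sqr_ge0.
have -> : lam ^+ 2 * (2 * M * ea * (W * `|g|) - c * K ^+ 2 / 2 * (W * kp)) =
  W * (lam ^+ 2 * (2 * M * (ea * `|g|) - c * K ^+ 2 / 2 * kp)) by ring.
rewrite ler_wpM2l//.
case: kp01 => ->.
  rewrite eq_sym oner_eq0 !mulr0 normr0 !mulr0 !addr0 expr0n/= mulr0 addr0 subr0.
  rewrite exprMn mulrCA ler_wpM2l// ler_wpM2l// mulr_ge0//.
rewrite eqxx !mulr1 !normrM (ger0_norm K0).
have -> : `|lam| * `|g| * (`|lam| * K) = lam ^+ 2 * (`|g| * K).
  by rewrite -[lam ^+ 2]real_normK ?num_real//; ring.
have gK : `|g| * K <= ea * K by rewrite ler_wpM2r.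
have -> : 2 * M * ((lam * g) ^+ 2 + lam ^+ 2 * (`|g| * K)) + - c * (lam * K) ^+ 2 =
  lam ^+ 2 * (2 * M * (g ^+ 2) + 2 * M * (`|g| * K) - c * K ^+ 2) by ring.
rewrite ler_wpM2l//.
have h1 : 2 * M * g ^+ 2 <= 2 * M * (ea * `|g|) by rewrite ler_wpM2l// mulr_ge0.
have h2 : 2 * M * (`|g| * K) <= 2 * M * (ea * K) by rewrite ler_wpM2l// mulr_ge0.
move: h1 h2 small.
have -> : 2 * M * K * ea = 2 * M * (ea * K) by ring.
set q := c * K ^+ 2; lra.
Qed.

Lemma small_scale (a T : R) (c1 c2 c3 : R) : 0 < a -> 0 < T ->
  0 < c1 -> 0 < c2 -> 0 < c3 ->
  exists e : R, [/\ 0 < e, e < T, e `^ a < c1, e `^ a < c2 & e < c3].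
Proof.
move=> a0 T0 c10 c20 c30.
have pw c : 0 < c -> \forall e \near (0 : R)^'+, e `^ a < c.
  move=> c0; have /cvgrPdist_lt/(_ _ c0) := powR_cvg0 a0.
  by apply: filterS => e; rewrite sub0r normrN ger0_norm// powR_ge0.
near (0 : R)^'+ => e; exists e; split.
- by near: e; exact: nbhs_right_gt.
- by near: e; exact: nbhs_right_lt.
- by near: e; exact: pw.
- by near: e; exact: pw.
- by near: e; exact: nbhs_right_lt.
Unshelve. all: by end_near. Qed.

(* Second-order control of the terminal cost *)
End SecondVariation.

Section TerminalCost.
Context {R : realType} {n : nat}.
Local Notation V := 'cV[R]_n.

Lemma within_open_continuous (T W : topologicalType) (U : set T) (f : T -> W) (x : T) :
  open U -> U x -> {within U, continuous f} -> {for x, continuous f}.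
Proof.
move=> oU Ux /subspace_continuousP cf P fP.
have nU : nbhs x U by exact: open_nbhs_nbhs.
by have nP := cf x Ux P fP; apply: filterS2 nU nP => y Uy; apply.
Qed.

Lemma terminal_cost_bounded (U : set V) (l : V -> R) (x r : V) :
  open U -> U x -> C2_on U l ->
  exists2 rho : R, 0 < rho & exists2 M : R, 0 <= M &
    forall y, `|y - x| < rho ->
     [/\ partially_derivable l y, {for y, continuous (grad l)},
         partially_derivable (grad l) y, {for y, continuous (jac (grad l))}
       & dotp (jac (grad l) y *m r) r <= M].
Proof.
move=> oU Ux [dl _ cg cj].
have nU : nbhs x U by exact: open_nbhs_nbhs.
have cf : (fun y => dotp (jac (grad l) y *m r) r) @ x -->
    dotp (jac (grad l) x *m r) r.
  apply: (@cvg_comp _ _ _ (jac (grad l)) (fun A : 'M[R]_n => dotp (A *m r) r)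
    _ (nbhs (jac (grad l) x))); last exact: mx_form_continuous.
  exact: (within_open_continuous oU Ux cj).
have /cvgrPdist_lt/(_ _ ltr01) nf := cf.
have /nbhs_ballP[rho /= rho0 rhoP] : nbhs x [set y | U y /\
    `|dotp (jac (grad l) x *m r) r - dotp (jac (grad l) y *m r) r| < 1].
  exact: filterI.
exists rho => //; exists (`|dotp (jac (grad l) x *m r) r| + 1).
  by rewrite addr_ge0.
move=> y yx; have [|Uy fy] := rhoP y; first by rewrite -ball_normE/= distrC.
have [d1 d2] := dl _ Uy.
split; [exact: d1| |exact: d2| |].
- exact: (within_open_continuous oU Uy cg).
- exact: (within_open_continuous oU Uy cj).
- move: fy; rewrite /= ltr_distlC => /andP[_ /ltW fy].
  by apply: le_trans fy _; rewrite lerD2r ler_norm.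
Qed.

End TerminalCost.

(** * Local data along the graph of the minimizer *)

Section LegendreCondition.
Context {R : realType} {n : nat}.
Local Notation mu := (@lebesgue_measure R).
Local Notation V := 'cV[R]_n.

Lemma caputo_graph_bounded (t0 t1 a : R) (L : R -> V -> V -> R)
    (U : set (R * V * V)) (r : V) (x : R -> V) (S : seq R) :
  open U -> caputo_graph t0 t1 a x `<=` U ->
  lagrangian_C2_on L (U `&` [set p | t0 <= p.1.1 <= t1]) ->
  {within `[t0, t1], continuous x} ->
  (forall t, t \in S -> t0 < t < t1) ->
  (forall t, t0 <= t <= t1 -> t \notin S -> caputo_cont t0 t1 a x t) ->
  (forall t, t \in S -> cvg (caputo t0 t1 a x s @[s --> t^'-]) /\
    cvg (caputo t0 t1 a x s @[s --> t^'+])) ->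
  exists2 rho : R, 0 < rho & forall s, t0 <= s <= t1 -> s \notin S ->
    forall u v, `|u - x s| < rho -> `|v - caputo t0 t1 a x s| < rho ->
      lagrangian_bounded L U r rho^-1 (s, u, v).
Proof.
move=> oU gU LC2 cx Sin Scont Slim.
apply: (@lagrangian_bounded_uniform R n t0 t1 L U r x (caputo t0 t1 a x) S
  oU LC2 cx) => t tin.
(* The split is on continuity rather than on membership in [S], which may contain continuity points:
   the one-sided limits are put into the graph only where continuity fails. *)
have [ct|nct] := pselect (caputo_cont t0 t1 a x t).
  left; split; last exact: ct.2.
  apply: gU; split; first by [].
  by left; split; [exact: tin|split; [exact: ct.1|reflexivity]].
right; have tS : t \in S.
  by apply/negPn/negP => /(Scont _ tin).
have [cl cr] := Slim _ tS; have tin' := Sin _ tS.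
split; [exact: tS|exact: tin'| |].
- exists (lim (caputo t0 t1 a x s @[s --> t^'-])); last exact: cl.
  apply: gU; split; first by [].
  by right; split; [exact: tin'|split; [exact: nct|left; exact: cl]].
- exists (lim (caputo t0 t1 a x s @[s --> t^'+])); last exact: cr.
  apply: gU; split; first by [].
  by right; split; [exact: tin'|split; [exact: nct|right; exact: cr]].
Qed.

Lemma L_yy_form_near (t0 t1 a ts : R) (L : R -> V -> V -> R)
    (U : set (R * V * V)) (r : V) (x : R -> V) :
  open U -> caputo_graph t0 t1 a x `<=` U ->
  lagrangian_C2_on L (U `&` [set p | t0 <= p.1.1 <= t1]) ->
  {within `[t0, t1], continuous x} -> t0 <= ts <= t1 ->
  caputo_cont t0 t1 a x ts ->
  dotp (L_yy L ts (x ts) (caputo t0 t1 a x ts) *m r) r < 0 ->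
  exists c eta rho : R, [/\ 0 < c, 0 < eta, 0 < rho &
    forall s, t0 <= s <= t1 -> `|s - ts| < eta ->
    forall v, `|v - caputo t0 t1 a x s| < rho ->
      dotp (L_yy L s (x s) v *m r) r <= - c].
Proof.
move=> oU gU [_ [_ _ _ _ [_ cyy]]] /subspace_continuousP cx tin cts neg.
(* Half of the strict negativity is kept on a whole neighborhood. *)
pose y := caputo t0 t1 a x; pose c := - dotp (L_yy L ts (x ts) (y ts) *m r) r / 2.
have c0 : 0 < c by rewrite /c; move: neg; rewrite -/(y ts); lra.
have Up : U (ts, x ts, y ts).
  apply: gU; split; first by [].
  by left; split; [exact: tin|split; [exact: cts.1|reflexivity]].
have nU : nbhs (ts, x ts, y ts) U by exact: open_nbhs_nbhs.
have near_form : \forall p \near (ts, x ts, y ts), t0 <= p.1.1 <= t1 ->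
    dotp (L_yy L p.1.1 p.1.2 p.2 *m r) r <= - c.
  have := within_continuous_near (@form_within_continuous R n r _ _ cyy) (conj Up tin) c0.
  move=> H; apply: filterS2 nU H => p Upp H pin.
  have {H} := H (conj Upp pin).
  rewrite /= ltr_distlC => /andP[_ /ltW H]; apply: le_trans H _.
  by rewrite /c; lra.
have FF : Filter (within `[t0, t1] (nbhs ts)) by exact: within_filter.
have ct : s @[s --> within `[t0, t1] (nbhs ts)] --> ts by apply: cvg_within_filter.
have cxt : x s @[s --> within `[t0, t1] (nbhs ts)] --> x ts.
  by apply: cx; rewrite /= in_itv.
have [rho rho0] := near_path FF ct cxt cts.2 near_form.
rewrite near_withinE => /nbhs_ballP[eta /= eta0 etaP].
exists c, eta, rho; split; [exact: c0|exact: eta0|exact: rho0|].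
move=> s sin sts v vs.
have := etaP s; rewrite -ball_normE/= distrC in_itv/= => /(_ sts sin).
move=> /(_ (x s) v); rewrite subrr normr0 => /(_ rho0 vs sin); exact.
Qed.

Lemma variation_cost_integrable (t0 t1 a b ts e c d rho B : R)
    (L : R -> V -> V -> R) (U : set (R * V * V)) (r : V) (x : R -> V) (S : seq R) :
  0 < b -> 0 < a <= 1 -> t0 < ts -> 0 < e -> ts + e < t1 ->
  lagrangian_C2_on L (U `&` [set p | t0 <= p.1.1 <= t1]) ->
  PCalpha t0 t1 a x ->
  (forall t, t0 <= t <= t1 -> t \notin S -> caputo_cont t0 t1 a x t) ->
  (forall s, t0 <= s <= t1 -> s \notin S ->
    forall u v, `|u - x s| < rho -> `|v - caputo t0 t1 a x s| < rho ->
      lagrangian_bounded L U r rho^-1 (s, u, v)) ->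
  (forall s, t0 <= s <= t1 -> `|bump a ts e s - d| <= B) ->
  `|c| * (B * `|r|) < rho -> `|c| * (caputo_cst a * `|r|) < rho ->
  mu.-integrable `[t0, t1] (EFin \o (fun s => (t1 - s) `^ (b - 1) *
    L s (variation x a ts e c d r s)
        (caputo t0 t1 a (variation x a ts e c d r) s))).
Proof.
move=> b0 a01 t0ts e0 tse [_ [cL _ _ _ _]] PCx Scont rhoP bB cB cK.
have t01 : t0 < t1 by lra.
have K0 := caputo_cst_gt0 a01.
have [cx _ _] := PCx.
have [cv _ [S' [_ Scont' _]]] :=
  PCalpha_variation c d r a01 t0ts e0 tse PCx.
(* Off the first list the derivative formula places the varied path in the tube; off [S'] the varied
   derivative is continuous. *)
apply: (@cost_integrable R n t0 t1 b rho^-1 L U _ _ ([:: ts, ts + e & S] ++ S')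
  b0 cL cv) => s sin.
rewrite mem_cat !inE !negb_or => /andP[/and3P[s1 s2 sS] sS'].
have [ds _] := Scont _ sin sS; have [_ cs] := Scont' _ sin sS'.
have [_ yE] := caputo_variation c d r t01 a01 (ltW t0ts) e0 sin cx s1 s2 ds.
have [||Us [bL _ _ _]] := rhoP s sin sS (variation x a ts e c d r s)
  (caputo t0 t1 a (variation x a ts e c d r) s).
- rewrite /variation [x s + _]addrC addrK normrZ normrM -mulrA (le_lt_trans _ cB)//.
  by rewrite ler_wpM2l// ler_wpM2r// bB.
- rewrite yE [_ + _ *: r]addrC addrK normrZ !normrM (ger0_norm (ltW K0)).
  rewrite -!mulrA (le_lt_trans _ cK)// ler_wpM2l// ler_wpM2l ?(ltW K0)//.
  by rewrite /pulse; case: ifP => _; rewrite ?normr1 ?normr0 ?mul1r ?mul0r.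
split; [exact: cs|exact: Us|exact: bL].
Qed.

End LegendreCondition.

(** * Choice of the scale and the final contradiction *)

Section Smallness.
Context {R : realType}.

(** With q = c K^2 the gain is q w e / 2. The factors 8 keep the two errors below q w e / 4 and q w
    e / 8, and the added 1 keeps the denominators positive. *)
Lemma second_variation_lt0 (M C Ml K c w e ea dd IG IK : R) :
  0 < M -> 0 <= C -> 0 <= Ml -> 0 < K -> 0 < c -> 0 < w -> 0 < e -> 0 <= ea ->
  ea < c * K ^+ 2 * w / (8 * (M * C + 1)) ->
  e < c * K ^+ 2 * w / (8 * (Ml * C ^+ 2 + 1)) ->
  0 <= dd -> dd <= C * e -> IG <= C * e -> w * e <= IK ->
  2 * M * ea * IG - c * K ^+ 2 / 2 * IK + Ml * dd ^+ 2 < 0.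
Proof.
move=> M0 C0 Ml0 K0 c0 w0 e0 ea0.
set q := c * K ^+ 2; have q0 : 0 < q by rewrite mulr_gt0// exprn_gt0.
have MC : 0 <= M * C by rewrite mulr_ge0// ltW.
have MlC : 0 <= Ml * C ^+ 2 by rewrite mulr_ge0// sqr_ge0.
rewrite ltr_pdivlMr; last by lra.
rewrite ltr_pdivlMr; last by lra.
move=> ea1 e1 dd0 dd1 IG1 IK1.
have h1 : 2 * M * ea * IG <= 2 * (M * C * ea) * e.
  rewrite (@le_trans _ _ (2 * M * ea * (C * e)))//.
    by rewrite ler_wpM2l// !mulr_ge0// ltW.
  by rewrite le_eqVlt; apply/orP; left; apply/eqP; ring.
have h2 : q / 2 * (w * e) <= q / 2 * IK by rewrite ler_wpM2l// divr_ge0// ltW.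
have h3 : Ml * dd ^+ 2 <= Ml * C ^+ 2 * e * e.
  rewrite (@le_trans _ _ (Ml * (C * e) ^+ 2))//.
    by rewrite ler_wpM2l// lerXn2r// ?nnegrE// mulr_ge0// ltW.
  by rewrite le_eqVlt; apply/orP; left; apply/eqP; ring.
have k1 : 8 * (M * C * ea) * e <= q * w * e by rewrite ler_wpM2r ?ltW//; lra.
have k2 : 8 * (Ml * C ^+ 2 * e) * e <= q * w * e by rewrite ler_wpM2r ?ltW//; lra.
have k3 : 0 < q * w * e by rewrite !mulr_gt0.
move: h1 h2 h3 k1 k2 k3.
have -> : q / 2 * (w * e) = q * w * e / 2 by ring.
have -> : 8 * (M * C * ea) * e = 4 * (2 * (M * C * ea) * e) by ring.
have -> : 8 * (Ml * C ^+ 2 * e) * e = 8 * (Ml * C ^+ 2 * e * e) by ring.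
lra.
Qed.

End Smallness.

Theorem theorem4p4 (R : realType) (n : nat) (t0 t1 : R) (x1 : 'cV[R]_n)
    (alpha beta : R) (L : R -> 'cV[R]_n -> 'cV[R]_n -> R) (l : 'cV[R]_n -> R)
    (x0 : R -> 'cV[R]_n) :
  t0 < t1 -> 0 < alpha -> alpha <= 1 -> 0 < beta ->
  weak_local_min t0 t1 x1 alpha beta L l x0 ->
  (exists U : set (R * 'cV[R]_n * 'cV[R]_n),
     [/\ open U, caputo_graph t0 t1 alpha x0 `<=` U
       & lagrangian_C2_on L (U `&` [set p | t0 <= p.1.1 <= t1])]) ->
  (exists U : set 'cV[R]_n, [/\ open U, U (x0 t0) & C2_on U l]) ->
  forall t : R, t0 < t < t1 -> caputo_cont t0 t1 alpha x0 t ->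
  forall r : 'cV[R]_n,
    0 <= dotp (L_yy L t (x0 t) (caputo t0 t1 alpha x0 t) *m r) r.
Proof.
move=> t01 a0 a1 b0 [[PC0 x0t1] [d d0 dP]] [U [oU gU LC2]] [Ul [oUl Ulx lC2]].
move=> ts /andP[t0ts tst1] cts r; rewrite leNgt; apply/negP => neg.
have a01 : 0 < alpha <= 1 by rewrite a0.
have K0 := caputo_cst_gt0 a01; set K := caputo_cst alpha in K0.
have [cx0 _ [S [Sin Scont Slim]]] := PC0.
have tsin : t0 <= ts <= t1 by rewrite !ltW.
have [rho rho0 rhoP] :=
  @caputo_graph_bounded R n t0 t1 alpha L U r x0 S oU gU LC2 cx0 Sin Scont Slim.
have [c [eta [rho1 [c0 eta0 rho10 formP]]]] :=
  @L_yy_form_near R n t0 t1 alpha ts L U r x0 oU gU LC2 cx0 tsin cts neg.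
have [rl rl0 [Ml Ml0 lP]] :=
  @terminal_cost_bounded R n Ul l (x0 t0) r oUl Ulx lC2.
have [C C0 CP] := bump_weight_bound a01 b0 (ltW t0ts) tst1.
have [w w0 wP] := pulse_weight_bound b0 (ltW t0ts) tst1.
have M0 : 0 < rho^-1 by rewrite invr_gt0.
(* The bounds on [e], in order: validity of the weight estimates and negativity of L_yy on the
   pulse; absorption of the cross term, 2 M K e^a <= c K^2 / 2 with M = 1/rho; the two conditions of
   [second_variation_lt0]. *)
have [e [e0 eT ea1 ea2 e3]] : exists e : R, [/\ 0 < e,
    e < Num.min ((t1 - ts) / 4) eta, e `^ alpha < c * K / (4 * rho^-1),
    e `^ alpha < c * K ^+ 2 * w / (8 * (rho^-1 * C + 1)) &
    e < c * K ^+ 2 * w / (8 * (Ml * C ^+ 2 + 1))].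
  have K20 : 0 < c * K ^+ 2 * w by rewrite !mulr_gt0// exprn_gt0.
  apply: small_scale; first exact: a0.
  - by rewrite lt_min eta0 andbT divr_gt0// subr_gt0.
  - by rewrite divr_gt0// !mulr_gt0.
  - by rewrite divr_gt0// mulr_gt0// ltr_wpDl// mulr_ge0// ltW.
  - by rewrite divr_gt0// mulr_gt0// ltr_wpDl// mulr_ge0// sqr_ge0.
move: eT; rewrite lt_min => /andP[eT eeta].
have tse : ts + e < t1 by clear -e0 eT t0ts tst1; lra.
have [ddC ig IG] := CP e e0 (ltW eT); have [ik IK] := wP e e0 (ltW eT).
set ea := e `^ alpha in ea1 ea2; have ea0 : 0 <= ea by exact: powR_ge0.
set dd := bump alpha ts e t1 in ddC ig IG.
have bge s : 0 <= bump alpha ts e s by apply: bump_ge0; exact: ltW.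
have ble s : bump alpha ts e s <= ea by apply: bump_le => //; exact: ltW.
have gB s : t0 <= s <= t1 -> `|bump alpha ts e s - dd| <= ea.
  move=> _; have := bge s; have := ble s; have := bge t1; have := ble t1.
  rewrite -/dd; clear => *; rewrite ler_distl; apply/andP; split; lra.
(* [Q] dominates every coefficient of [lam] in the smallness conditions, and [mm] is the smallest
   admissible radius; one [lam], chosen after [e], meets them all. *)
pose Q := ea * enorm r + n%:R * (K * `|r|) + (ea * `|r| + K * `|r|) + 1.
pose mm := Num.min d (Num.min (Num.min rho rho1) rl).
have Kr0 : 0 <= K * `|r| by rewrite mulr_ge0// ltW.
have er0 : 0 <= ea * `|r| by rewrite mulr_ge0.
have en0 : 0 <= ea * enorm r by rewrite mulr_ge0// enorm_ge0.
have nK0 : 0 <= n%:R * (K * `|r|) by rewrite mulr_ge0.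
have Q0 : 0 < Q by rewrite /Q; clear -Kr0 er0 en0 nK0; lra.
have mm0 : 0 < mm by rewrite !lt_min d0 rho0 rho10 rl0.
pose lam := mm / (2 * Q).
have lam0 : 0 < lam by rewrite divr_gt0// mulr_gt0.
have lamQ q : q <= Q -> lam * q < mm.
  move=> qQ; apply: (@le_lt_trans _ _ (lam * Q)); first by rewrite ler_wpM2l// ltW.
  have -> : lam * Q = mm / 2 by rewrite /lam; field; rewrite gt_eqF.
  by clear -mm0; lra.
clearbody lam.
have /lamQ : ea * enorm r + n%:R * (K * `|r|) <= Q.
  by rewrite /Q; clear -Kr0 er0; lra.
rewrite lt_min => /andP[lam_d _].
have /lamQ : ea * `|r| <= Q by rewrite /Q; clear -Kr0 en0 nK0; lra.
rewrite !lt_min => /andP[_ /andP[/andP[ler_rho ler_rho1] ler_rl]].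
have /lamQ : K * `|r| <= Q by rewrite /Q; clear -er0 en0 nK0; lra.
rewrite !lt_min => /andP[_ /andP[/andP[lKr_rho lKr_rho1] _]].
have J sg : `|sg| = lam ->
    cost t0 t1 alpha beta L l x0 <=
    cost t0 t1 alpha beta L l (variation x0 alpha ts e sg dd r) /\
    lebesgue_measure.-integrable `[t0, t1]
      (EFin \o (fun s => (t1 - s) `^ (beta - 1) *
        L s (variation x0 alpha ts e sg dd r s)
          (caputo t0 t1 alpha (variation x0 alpha ts e sg dd r) s))).
  move=> sgE; split; last first.
    apply: (@variation_cost_integrable R n t0 t1 alpha beta ts e sg dd rho ea L U r
      x0 S b0 a01 t0ts e0 tse LC2 PC0 Scont rhoP gB); rewrite sgE.
    + exact: ler_rho.
    + exact: lKr_rho.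
  apply: dP.
    split; first exact: (PCalpha_variation sg dd r a01 t0ts e0 tse PC0).
    by rewrite /variation subrr mulr0 scale0r addr0 x0t1.
  apply: le_lt_trans (weak_dist_variation x0 sg r t01 a01 (ltW t0ts) e0 gB) _.
  by rewrite sgE lte_fin.
have [Jp ip] := J lam (ger0_norm (ltW lam0)).
have [Jm im] := J (- lam) (etrans (normrN _) (ger0_norm (ltW lam0))).
have i0 : lebesgue_measure.-integrable `[t0, t1]
    (EFin \o (fun s => (t1 - s) `^ (beta - 1) *
      L s (x0 s) (caputo t0 t1 alpha x0 s))).
  have [_ [cL _ _ _ _]] := LC2.
  apply: (@cost_integrable R n t0 t1 beta rho^-1 L U x0 _ S b0 cL cx0) => s sin sS.
  have [||Us [bL _ _ _]] := rhoP s sin sS (x0 s) (caputo t0 t1 alpha x0 s).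
  - by rewrite subrr normr0.
  - by rewrite subrr normr0.
  split; [exact: (Scont s sin sS).2|exact: Us|exact: bL].
pose N : set R := [set` [:: ts, ts + e & S]].
have lle : l (variation x0 alpha ts e lam dd r t0) +
    l (variation x0 alpha ts e (- lam) dd r t0) - 2 * l (x0 t0) <=
    lam ^+ 2 * (Ml * dd ^+ 2).
  (* The bump vanishes at [t0], so the initial point moves only by the constant that restores the
     end condition at [t1]. *)
  rewrite /variation (bump_before a0 (ltW e0) (ltW t0ts)) sub0r.
  have -> : (- lam * - dd) *: r = - ((lam * - dd) *: r).
    by rewrite mulNr scaleNr.
  apply: le_trans (@second_difference_le R n l (x0 t0) r rl Ml (lam * - dd) lP _) _.
    rewrite normrZ normrM normrN (ger0_norm (ltW lam0)) (ger0_norm (bge t1)).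
    apply: le_lt_trans ler_rl; rewrite -mulrA ler_wpM2l ?(ltW lam0)//.
    by rewrite ler_wpM2r// ble.
  by rewrite le_eqVlt; apply/orP; left; apply/eqP; ring.
have pt s : `[t0, t1]%classic s -> ~ N s ->
    (t1 - s) `^ (beta - 1) * L s (variation x0 alpha ts e lam dd r s)
       (caputo t0 t1 alpha (variation x0 alpha ts e lam dd r) s) +
    (t1 - s) `^ (beta - 1) * L s (variation x0 alpha ts e (- lam) dd r s)
       (caputo t0 t1 alpha (variation x0 alpha ts e (- lam) dd r) s) -
    2 * ((t1 - s) `^ (beta - 1) * L s (x0 s) (caputo t0 t1 alpha x0 s)) <=
    lam ^+ 2 * (2 * rho^-1 * ea *
       ((t1 - s) `^ (beta - 1) * `|bump alpha ts e s - dd|) -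
     c * K ^+ 2 / 2 * ((t1 - s) `^ (beta - 1) * pulse ts e s)).
  rewrite /= in_itv/= => sin; rewrite /N /= !inE => /negP.
  rewrite !negb_or => /and3P[s1 s2 sS].
  have [ds _] := Scont s sin sS.
  have [_ yp] := caputo_variation lam dd r t01 a01 (ltW t0ts) e0 sin cx0 s1 s2 ds.
  have [_ ym] := caputo_variation (- lam) dd r t01 a01 (ltW t0ts) e0 sin cx0 s1 s2 ds.
  rewrite {}yp {}ym /variation -/K !mulNr !scaleNr.
  set W := (t1 - s) `^ (beta - 1); set g := bump alpha ts e s - dd.
  set kp := pulse ts e s.
  have W0 : 0 <= W by exact: powR_ge0.
  have kp01 : kp = 0 \/ kp = 1.
    by rewrite /kp /pulse; case: ifP => _; [right|left].
  (* Negativity of L_yy is known only near [ts], hence on the pulse. Elsewhere the uniform bound is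
     taken, and its contribution vanishes because kp = 0. *)
  have H := @lagrangian_second_difference R n t0 t1 L U r s (x0 s)
    (caputo t0 t1 alpha x0 s) (Num.min rho rho1) rho^-1
    (if kp == 1 then - c else rho^-1) (lam * g) (lam * K * kp) oU LC2 sin.
  have {}H := H _ _ _ _.
  set L1 := L s (x0 s + _) _; set L2 := L s (x0 s - _) _; set L3 := L s (x0 s) _.
  have -> : W * L1 + W * L2 - 2 * (W * L3) = W * (L1 + L2 - 2 * L3) by ring.
  apply: (@le_trans _ _ (W * (2 * rho^-1 * ((lam * g) ^+ 2 + `|lam * g| *
    `|lam * K * kp|) + (if kp == 1 then - c else rho^-1) * (lam * K * kp) ^+ 2))).
    rewrite ler_wpM2l//; apply: H.
    - move=> u v; rewrite !lt_min => /andP[us _] /andP[vs _]; exact: rhoP.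
    - move=> v; rewrite lt_min => /andP[vs vs1].
      rewrite /kp /pulse; have [/andP[ts_s s_tse]|_] :=
        boolP (ts < s < ts + e).
        rewrite eqxx; apply: formP => //.
        rewrite ger0_norm; last by rewrite subr_ge0 ltW.
        by apply: lt_trans eeta; rewrite ltrBlDl.
      rewrite eq_sym oner_eq0.
      have [|_ [_ _ _ h]] := rhoP s sin sS (x0 s) v _ vs.
        by rewrite subrr normr0.
      exact: le_trans (ler_norm _) h.
    - rewrite normrZ normrM (ger0_norm (ltW lam0)) -mulrA lt_min.
      have gle : lam * (`|g| * `|r|) <= lam * (ea * `|r|).
        by rewrite ler_wpM2l ?(ltW lam0)// ler_wpM2r// gB.
      by rewrite !(le_lt_trans gle).
    - rewrite normrZ !normrM (ger0_norm (ltW lam0)) (ger0_norm (ltW K0)) lt_min.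
      have kle : lam * K * `|kp| * `|r| <= lam * (K * `|r|).
        rewrite -!mulrA ler_wpM2l ?(ltW lam0)// ler_wpM2l ?(ltW K0)//.
        by case: kp01 => ->; rewrite ?normr0 ?normr1 ?mul0r ?mul1r.
      by rewrite !(le_lt_trans kle).
  apply: second_variation_integrand_le => //.
  - exact: ltW.
  - exact: ltW.
  - exact: gB.
  - move: ea1; rewrite ltr_pdivlMr; last by rewrite mulr_gt0.
    move=> /ltW h; have := ler_wpM2r (ltW K0) h.
    clear; set q := rho^-1; clearbody q => h.
    have -> : 2 * q * K * ea = ea * (4 * q) * K / 2 by field.
    have -> : c * K ^+ 2 / 2 = c * K * K / 2 by ring.
    lra.
have := @second_variation_ge0 R `[t0, t1] N _ _ _ _ _ lam (c * K ^+ 2 / 2)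
  (2 * rho^-1 * ea) (Ml * dd ^+ 2) (l (x0 t0)) _ _ (measurable_itv _)
  (measurable_seq _) (lebesgue_measure_seq _) lam0 i0 ip im ig ik pt Jp Jm lle.
apply/negP; rewrite -ltNge.
exact: (second_variation_lt0 M0 C0 Ml0 K0 c0 w0 e0 ea0 ea2 e3 (bge t1) ddC IG IK).
Qed.
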